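(* Let the hypotheses of Lemma 4.1 hold: $m\ge1$, $q,q_i\in[1,\infty)$, $r_i\in(1,\infty)$, $\alpha_i\in(-n,nr_i/r_i')$, $\sum_i\frac1{q_i}+\sum_i\frac1{r_i}=\frac1q$, $\sum_i\frac{\alpha_i}{q_i}+\sum_i\frac{\alpha_i}{r_i}=\frac\alpha q$, $\omega(x)=|x|_p^\alpha$, $\omega_i(x)=|x|_p^{\alpha_i}$, $b_i\in CMO^{r_i}_{\omega_i}(\mathbb Q_p^n)$. Assume $$\mathcal C_5=\int_{\mathbb Q_p^n}\frac{\Phi(y)}{|y|_p^n}\prod_{i=1}^m\psi_i(y)\mu_i(y)\,dy<\infty,$$ with $\psi_i,\mu_i$ as below. Then for every $\gamma\in\mathbb Z$, $\mathcal H^p_{\Phi,\vec A,\vec b}$ is bounded from $L^{q_1}_{\omega_1}(\mathbb Q_p^n)\times\cdots\times L^{q_m}_{\omega_m}(\mathbb Q_p^n)$ to $L^q_\omega(B_\gamma)$ (with a bound that may depend on $\gamma$).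
   Context: Let $p$ be a prime, $\mathbb Q_p$ the $p$-adic numbers with absolute value $|\cdot|_p$; for $x\in\mathbb Q_p^n$, $|x|_p=\max_j|x_j|_p$. $dx$ is the Haar measure on $\mathbb Q_p^n$ normalized so that $B_0$ has measure 1, $|E|$ the measure of $E$, $B_\gamma=\{x:|x|_p\le p^\gamma\}$. For an $n\times n$ matrix $A=(a_{ij})$ over $\mathbb Q_p$, $\|A\|_p=\max_{i,j}|a_{ij}|_p$; $r'$ denotes the conjugate exponent $\frac1r+\frac1{r'}=1$. For a weight $\omega$, $\|f\|_{L^q_\omega(E)}=(\int_E|f|^q\omega)^{1/q}$, $\omega(E)=\int_E\omega$. $CMO^q_\omega(\mathbb Q_p^n)$: $f$ locally in $L^q_\omega$ with $\sup_{\gamma\in\mathbb Z}\big(\frac1{\omega(B_\gamma)}\int_{B_\gamma}|f-f_{B_\gamma}|^q\omega\big)^{1/q}<\infty$, $f_{B_\gamma}=\frac1{|B_\gamma|}\int_{B_\gamma}f$. Let $\Phi:\mathbb Q_p^n\to[0,\infty)$ be measurable and $A_i(y)$ $n\times n$ matrices over $\mathbb Q_p$, measurable in $y$, invertible a.e. $\mathcal H^p_{\Phi,\vec A,\vec b}(\vec f)(x)=\int\frac{\Phi(y)}{|y|_p^n}\prod_{i=1}^m\big(b_i(x)-b_i(A_i(y)x)\big)\prod_{i=1}^m f_i(A_i(y)x)\,dy$. Here $\psi_i(y)=1+\big(\max\{\|A_i^{-1}(y)\|_p^{\alpha_i},\|A_i(y)\|_p^{-\alpha_i}\}|\det A_i^{-1}(y)|_p\big)^{1/r_i}\|A_i(y)\|_p^{(n+\alpha_i)/r_i}+|\log_p\|A_i(y)\|_p|+2\|A_i(y)\|_p^n/|\det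 A_i(y)|_p$ and $\mu_i(y)=\big(\max\{\|A_i^{-1}(y)\|_p^{\alpha_i},\|A_i(y)\|_p^{-\alpha_i}\}|\det A_i^{-1}(y)|_p\big)^{1/q_i}$. *)

(* Defs.v *)
From HB Require Import structures.
From mathcomp Require Import all_boot all_order all_algebra.
From mathcomp Require Import all_classical all_reals all_analysis.
Set Implicit Arguments. Unset Strict Implicit. Unset Printing Implicit Defensive.
Import Order.TTheory GRing.Theory Num.Theory.
Local Open Scope classical_set_scope.
Local Open Scope ring_scope.

(* The field Q_p, characterised up to isometric isomorphism:           *)
(* a field K with an absolute value |.| : K -> R which is               *)
(* non-archimedean, satisfies |p| = 1/p, in which Q is dense and which  *)
(* is complete.  By Ostrowski's theorem |.| restricted to Q is the      *)
(* p-adic absolute value, so K is (isometrically isomorphic to) Q_p.    *)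
Record is_Qp (R : realType) (p : nat) (K : fieldType) (absK : K -> R) : Prop := {
  Qp_abs_ge0 : forall x, 0 <= absK x;
  Qp_abs_eq0 : forall x, absK x = 0 <-> x = 0;
  Qp_absM : forall x y, absK (x * y) = absK x * absK y;
  Qp_abs_ultra : forall x y, absK (x + y) <= Num.max (absK x) (absK y);
  Qp_abs_p : absK (p%:R) = (p%:R)^-1;
  Qp_rat_dense : forall x (e : R), 0 < e -> exists r : rat, absK (x - ratr r) < e;
  Qp_complete : forall u : nat -> K,
    (forall e : R, 0 < e -> exists N, forall k l, (N <= k)%N -> (N <= l)%N ->
        absK (u k - u l) < e) ->
    exists x, forall e : R, 0 < e -> exists N, forall k, (N <= k)%N ->
        absK (u k - x) < e }.

Definition Qpvec (K : fieldType) (n : nat) := 'cV[K]_n.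
HB.instance Definition _ (K : fieldType) (n : nat) :=
  Choice.on (Qpvec K n).
HB.instance Definition _ (K : fieldType) (n : nat) :=
  isPointed.Build (Qpvec K n) 0.

Definition vnorm (R : realType) (K : fieldType) (absK : K -> R) (n : nat)
  (x : 'cV[K]_n) : R := \big[Num.max/0]_(j < n) absK (x j ord0).

Definition mnorm (R : realType) (K : fieldType) (absK : K -> R) (n : nat)
  (A : 'M[K]_n) : R := \big[Num.max/0]_(i < n) \big[Num.max/0]_(j < n) absK (A i j).

Definition Qp_balls (R : realType) (p : nat) (K : fieldType) (absK : K -> R)
  (n : nat) : set (set (Qpvec K n)) :=
  [set B | exists (c : 'cV[K]_n) (g : int),
     B = [set x | vnorm absK (x - c) <= (p%:R : R) ^ g]].
Arguments Qp_balls {R} p {K} absK n.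

(* Q_p^n with its Borel sigma-algebra (generated by the balls) *)
Definition Qpn (R : realType) (p : nat) (K : fieldType) (absK : K -> R) (n : nat) :=
  g_sigma_algebraType (Qp_balls p absK n).
Arguments Qpn {R} p {K} absK n.

Definition Bg (R : realType) (p : nat) (K : fieldType) (absK : K -> R) (n : nat)
  (g : int) : set (Qpn p absK n) :=
  [set x | vnorm absK (x : 'cV[K]_n) <= (p%:R : R) ^ g].
Arguments Bg {R} p {K} absK n g.

Definition is_Haar (R : realType) (p : nat) (K : fieldType) (absK : K -> R)
  (n : nat) (mu : {measure set (Qpn p absK n) -> \bar R}) : Prop :=
  (forall (a : 'cV[K]_n) (A : set (Qpn p absK n)), measurable A ->
      mu [set (x : 'cV[K]_n) + a | x in A] = mu A)
  /\ mu (Bg p absK n 0) = 1%E.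

Section Weighted.
Variables (R : realType) (p : nat) (K : fieldType) (absK : K -> R) (n : nat).
Variable (mu : {measure set (Qpn p absK n) -> \bar R}).
Local Notation T := (Qpn p absK n).

Definition pw (a : R) : T -> R := fun x => (vnorm absK (x : 'cV[K]_n)) `^ a.

Definition wmeas (w : T -> R) (E : set T) : \bar R := (\int[mu]_(x in E) (w x)%:E)%E.

Definition wint (E : set T) (w : T -> R) (q : R) (f : T -> R) : \bar R :=
  (\int[mu]_(x in E) ((`|f x| `^ q) * w x)%:E)%E.

(* ||f||_{L^q_omega(E)} (meaningful when wint is finite) *)
Definition wnorm (E : set T) (w : T -> R) (q : R) (f : T -> R) : R :=
  (fine (wint E w q f)) `^ q^-1.

Definition in_wL (w : T -> R) (q : R) (f : T -> R) : Prop :=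
  measurable_fun setT f /\ (wint setT w q f < +oo)%E.

Definition bmean (f : T -> R) (g : int) : R :=
  fine (\int[mu]_(x in Bg p absK n g) (f x)%:E)%E / fine (mu (Bg p absK n g)).

Definition in_CMO (w : T -> R) (q : R) (f : T -> R) : Prop :=
  measurable_fun setT f /\
  (forall g : int, (wint (Bg p absK n g) w q f < +oo)%E) /\
  exists M : R, forall g : int,
    (fine (wint (Bg p absK n g) w q (fun x => f x - bmean f g))
       / fine (wmeas w (Bg p absK n g))) `^ q^-1 <= M.

End Weighted.

Definition logp (R : realType) (p : nat) (x : R) : R := ln x / ln (p%:R).

Definition psi_fn (R : realType) (p : nat) (K : fieldType) (absK : K -> R)
  (n : nat) (a r : R) (A : 'M[K]_n) : R :=
  1 + (Num.max (mnorm absK (invmx A) `^ a) (mnorm absK A `^ (- a))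
          * absK (\det (invmx A))) `^ r^-1
        * mnorm absK A `^ ((n%:R + a) / r)
    + `| logp p (mnorm absK A) |
    + 2 * mnorm absK A ^+ n / absK (\det A).

Definition mu_fn (R : realType) (K : fieldType) (absK : K -> R)
  (n : nat) (a q : R) (A : 'M[K]_n) : R :=
  (Num.max (mnorm absK (invmx A) `^ a) (mnorm absK A `^ (- a))
     * absK (\det (invmx A))) `^ q^-1.

Definition Hkernel (R : realType) (p : nat) (K : fieldType) (absK : K -> R)
  (n m : nat) (Phi : Qpn p absK n -> R) (A : 'I_m -> Qpn p absK n -> 'M[K]_n)
  (b f : 'I_m -> Qpn p absK n -> R) (x : Qpn p absK n) : Qpn p absK n -> R :=
  fun y => Phi y / (vnorm absK (y : 'cV[K]_n)) ^+ n
    * (\prod_(i < m) (b i x - b i (A i y *m (x : 'cV[K]_n) : Qpn p absK n)))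
    * (\prod_(i < m) f i (A i y *m (x : 'cV[K]_n) : Qpn p absK n)).

Definition Hop (R : realType) (p : nat) (K : fieldType) (absK : K -> R)
  (n m : nat) (mu : {measure set (Qpn p absK n) -> \bar R})
  (Phi : Qpn p absK n -> R) (A : 'I_m -> Qpn p absK n -> 'M[K]_n)
  (b f : 'I_m -> Qpn p absK n -> R) (x : Qpn p absK n) : R :=
  fine (\int[mu]_y (Hkernel Phi A b f x y)%:E)%E.

(* Main.v *)
Require Import Defs.
From HB Require Import structures.
From mathcomp Require Import all_boot all_order all_fingroup all_algebra.
From mathcomp Require Import all_classical all_reals all_analysis.
From mathcomp Require Import measurable_realfun.
From mathcomp Require Import ring lra zify.
Import Order.TTheory GRing.Theory Num.Theory.
Local Open Scope classical_set_scope.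
Local Open Scope ring_scope.

(** The operator is an average over [y], with the kernel
    [k(y) = Phi(y) / |y|^n * prod_i psi_i(y) mu_i(y)] of finite mass [C5], of
    [prod_i (|b_i(x) - b_i(A_i(y) x)| / psi_i(y)) * prod_i (|f_i(A_i(y) x)| / mu_i(y))].
    Since constants are free, Minkowski's and Hoelder's inequalities may be
    replaced by pointwise bounds: a product with exponents adding up to [1/q] is
    at most the [q]-th root of the sum of the corresponding powers, and Jensen's
    inequality for [k dy] follows from [s^(q-1) h <= s^q + h^q] by choosing [s]
    depending on [x].  Tonelli's theorem then reduces everything to two integrals
    over [x] for fixed [y].  The one with [f_i] is a change of variables
    [d(Ax) = |det A| dx].  For the one with [b_i], write [||A_i(y)|| = p^k] and
    go through the means of [b_i] over [B_g] and [B_(g+k)], whose difference is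
    [O(|k|)] because means over consecutive balls differ by [O(1)]; this is where
    [alpha_i < n r_i / r_i'] enters, making [|x|^(- alpha_i / (r_i - 1))] locally
    integrable.

    The change of variables rests on uniqueness of Haar measure: [A] multiplies
    it by a constant which is multiplicative in [A] and trivial on integral
    matrices with unit determinant, hence equal to [|det A|] by an LUP
    decomposition. *)

Set Implicit Arguments. Unset Strict Implicit. Unset Printing Implicit Defensive.

(** * The absolute value of Q_p *)

(** Replacing a product by a sum of powers destroys homogeneity, so every factor is normalised
    beforehand: [|b_i(x) - b_i(A_i(y) x)|] by [psi_i(y)], and [|f_i(A_i(y) x)|] by [mu_i(y) t_i],
    where [t_i] bounds the norm of [f_i]. Then each summand has an integral over [x] in [B_g] that
    is bounded independently of [y] and of the [f_i], and the product of the [t_i] comes out as a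
    factor. Dividing by [t_i] requires [t_i > 0], so vanishing norms need a limiting argument at the
    very end. On [B_g] the summand of [b_i] grows like [(P ^ g) ^ (n + alpha_i)] while that of [f_i]
    stays bounded by 1, so the constant obtained depends on [g]. Haar measure is given only by
    translation invariance and the mass of the unit ball. Every explicit value comes from two
    consequences of the density of Q: nonzero absolute values are integer powers of [p], and the
    residue field has the [p] elements [0, ..., p-1]. *)

Section AbsoluteValue.
Variables (R : realType) (p : nat) (K : fieldType) (absK : K -> R).
Hypotheses (p_pr : prime p) (QpK : is_Qp p absK).
Local Notation P := (p%:R : R).

Lemma P_gt1 : 1 < P. Proof. by rewrite ltr1n prime_gt1. Qed.

Lemma P_gt0 : 0 < P. Proof. by rewrite ltr0n prime_gt0. Qed.
Hint Resolve P_gt0 : core.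

Lemma Pz_gt0 (k : int) : 0 < P ^ k. Proof. exact: exprz_gt0. Qed.
Hint Resolve Pz_gt0 : core.

Lemma Pz_ge0 (k : int) : 0 <= P ^ k. Proof. exact: ltW. Qed.
Hint Resolve Pz_ge0 : core.

Lemma P_neq0 : P != 0. Proof. exact: lt0r_neq0. Qed.
Hint Resolve P_neq0 : core.

Lemma abs_ge0 x : 0 <= absK x. Proof. exact: (Qp_abs_ge0 QpK). Qed.
Hint Resolve abs_ge0 : core.

Lemma abs0 : absK 0 = 0. Proof. exact/(Qp_abs_eq0 QpK). Qed.

Lemma abs_eq0 x : (absK x == 0) = (x == 0).
Proof. by apply/eqP/eqP => /(Qp_abs_eq0 QpK). Qed.

Lemma abs_gt0 x : (0 < absK x) = (x != 0).
Proof. by rewrite lt_def abs_ge0 andbT abs_eq0. Qed.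

Lemma absM x y : absK (x * y) = absK x * absK y.
Proof. exact: (Qp_absM QpK). Qed.

Lemma abs1 : absK 1 = 1.
Proof.
have nz : absK 1 != 0 by rewrite abs_eq0 oner_eq0.
by apply: (mulfI nz); rewrite -absM !mulr1.
Qed.

Lemma absN x : absK (- x) = absK x.
Proof.
suff e : absK (-1) = 1 by rewrite -mulN1r absM e mul1r.
have := absM (-1) (-1); rewrite mulrNN mulr1 abs1 => /esym/eqP.
by rewrite -expr2 sqrp_eq1 // => /eqP.
Qed.

Lemma absB x y : absK (x - y) = absK (y - x).
Proof. by rewrite -absN opprB. Qed.

Lemma absX x k : absK (x ^+ k) = absK x ^+ k.
Proof.
by elim: k => [|k ih]; rewrite ?expr0 ?abs1 // !exprS absM ih.
Qed.

Lemma absV x : absK (x^-1) = (absK x)^-1.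
Proof.
have [->|x0] := eqVneq x 0; first by rewrite invr0 abs0 invr0.
have nz : absK x != 0 by rewrite abs_eq0.
by apply: (mulfI nz); rewrite -absM divff // divff // abs1.
Qed.

Lemma absXz x (k : int) : absK (x ^ k) = absK x ^ k.
Proof.
by case: k => k; rewrite ?NegzE -?exprnN ?absV absX.
Qed.

Lemma absP (k : int) : absK (p%:R ^ k) = P ^ (- k).
Proof. by rewrite absXz (Qp_abs_p QpK) exprz_inv. Qed.

Lemma absD_le x y c : absK x <= c -> absK y <= c -> absK (x + y) <= c.
Proof.
move=> xc yc; apply: le_trans (Qp_abs_ultra QpK _ _) _.
by rewrite ge_max xc.
Qed.

Lemma absB_le x y c : absK x <= c -> absK y <= c -> absK (x - y) <= c.
Proof. by move=> xc yc; apply: absD_le => //; rewrite absN. Qed.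

(** Ultrametric triangles are isosceles, the two longest sides being equal. Through density this
    carries values known for rationals over to all of [K]. *)
Lemma abs_dist_eq x y : absK (x - y) < absK x -> absK y = absK x.
Proof.
move=> xy; apply/eqP; rewrite eq_le; apply/andP; split.
  by rewrite -[y](subKr x); apply: absB_le => //; exact: ltW.
have := Qp_abs_ultra QpK (x - y) y; rewrite subrK le_max.
by case/orP => //; rewrite leNgt xy.
Qed.

Lemma abs_sum_le (I : Type) (r : seq I) (Q : pred I) (F : I -> K) c :
  0 <= c -> (forall i, Q i -> absK (F i) <= c) ->
  absK (\sum_(i <- r | Q i) F i) <= c.
Proof.
move=> c0 h; elim/big_ind : _ => //; first by rewrite abs0.
by move=> ? ? ? ?; apply: absD_le.
Qed.

Lemma abs_prod (I : Type) (r : seq I) (Q : pred I) (F : I -> K) :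
  absK (\prod_(i <- r | Q i) F i) = \prod_(i <- r | Q i) absK (F i).
Proof. by apply: big_morph; [exact: absM | exact: abs1]. Qed.

Lemma abs_nat k : absK k%:R <= 1.
Proof.
elim: k => [|k ih]; first by rewrite abs0.
by rewrite -addn1 natrD; apply: absD_le => //; rewrite abs1.
Qed.

Lemma abs_int (z : int) : absK z%:~R = absK (`|z|%N)%:R.
Proof. by case: z => k //; rewrite NegzE abszN mulrNz absN. Qed.

Lemma abs_int_le1 (z : int) : absK z%:~R <= 1.
Proof. by rewrite abs_int abs_nat. Qed.

Lemma abs_dvdn k : (p %| k)%N -> absK k%:R <= P^-1.
Proof.
move=> /dvdnP [j ->]; rewrite natrM absM (Qp_abs_p QpK).
by rewrite ler_piMl ?abs_nat // invr_ge0 ltW.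
Qed.

Lemma abs_dvdz (z : int) : (p %| z)%Z -> absK z%:~R <= P^-1.
Proof. by move=> pz; rewrite abs_int; apply: abs_dvdn. Qed.

(** Bezout gives [a] with [p] dividing [1 + a * k]. If [|k| < 1], this sum would have absolute value
    1, although it is at most [1/p]. *)
Lemma abs_coprime k : coprime p k -> absK k%:R = 1.
Proof.
move=> pk; apply/eqP; rewrite eq_le abs_nat /= leNgt; apply/negP => k1.
have [a _] := Bezoutl k (prime_gt0 p_pr); rewrite (eqP pk) => /abs_dvdn.
rewrite natrD (_ : absK _ = 1) ?leNgt ?invf_lt1 ?P_gt1 //.
rewrite -[RHS]abs1; apply: abs_dist_eq.
rewrite opprD addrA subrr sub0r absN abs1 natrM absM.
by apply: le_lt_trans k1; rewrite ler_piMl ?abs_nat.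
Qed.

Lemma abs_nat_val k : (0 < k)%N -> absK k%:R = P ^ (- (logn p k)%:Z).
Proof.
move=> k0; have [j pj {1}->] := pfactor_coprime p_pr k0.
by rewrite natrM absM abs_coprime // mul1r natrX absX (Qp_abs_p QpK) exprVn exprnN.
Qed.

Lemma natr_neq0 k : (0 < k)%N -> (k%:R : K) != 0.
Proof. by move=> k0; rewrite -abs_eq0 abs_nat_val // lt0r_neq0. Qed.

Lemma pK_neq0 : (p%:R : K) != 0.
Proof. exact: natr_neq0 (prime_gt0 p_pr). Qed.

(** A rational closer to [x] than [|x|] has the same absolute value as [x]. *)
Lemma abs_val x : x != 0 -> exists k : int, absK x = P ^ k.
Proof.
rewrite -abs_gt0 => x0; have [r xr] := Qp_rat_dense QpK x x0.
have := abs_dist_eq xr; rewrite /ratr absM absV !abs_int => e.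
have r0 : (0 < `|numq r|)%N.
  rewrite lt0n; apply/negP => /eqP r0.
  by move: e x0; rewrite r0 abs0 mul0r => <-; rewrite ltxx.
have d0 : (0 < `|denq r|)%N by rewrite absz_gt0 denq_neq0.
by rewrite -e !abs_nat_val // invr_expz -expfzDr //; eexists.
Qed.

Lemma le_Pz (k l : int) : (P ^ k <= P ^ l) = (k <= l).
Proof. by rewrite ler_eXz2l ?P_gt1. Qed.

Lemma PzD (k l : int) : P ^ (k + l) = P ^ k * P ^ l.
Proof. by rewrite expfzDr. Qed.

(** A rational [a/d] close to [x] has a denominator prime to [p], so it is congruent modulo [p] to
    an integer, which is then reduced to its digit. *)
Lemma abs_residue x : absK x <= 1 -> exists i : 'I_p, absK (x - i%:R) <= P^-1.
Proof.
move=> x1; have P1 : P^-1 < 1 by rewrite invf_lt1 ?P_gt1.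
have iP0 : 0 < P^-1 by rewrite invr_gt0.
have [r xr] := Qp_rat_dense QpK x iP0.
have r1 : absK (ratr r) <= 1.
  rewrite -[ratr r](subKr x); apply: absB_le => //.
  exact: le_trans (ltW xr) (ltW P1).
set a := numq r; set d := `|denq r|%N.
have rE : ratr r = a%:~R / d%:R :> K.
  by rewrite /ratr [d%:R]pmulrn /d absz_denq.
have pd : coprime p d.
  rewrite prime_coprime //; apply/negP => pd.
  have pa : coprime p `|a|%N.
    by apply: coprime_dvdl pd _; rewrite coprime_sym; exact: coprime_num_den.
  move: r1; rewrite rE absM absV abs_int (abs_coprime pa) mul1r.
  have d0 : 0 < absK d%:R by rewrite abs_gt0 natr_neq0 // /d absz_gt0 denq_neq0.
  rewrite invf_le1 // leNgt => /negP; apply.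
  exact: le_lt_trans (abs_dvdn pd) P1.
have [e _] := Bezoutl d (prime_gt0 p_pr); rewrite (eqP pd) => pe.
(* Since [p] divides [1 + e * d], [- e] inverts [d] modulo [p], and [w] represents [a/d]. *)
set w : int := - (e%:Z * a).
have wm : (0 <= (w %% p)%Z < p)%R.
  by rewrite modz_ge0 ?ltz_pmod // ?ltz_nat ?prime_gt0 // -lt0n prime_gt0.
have ip : (`|(w %% p)%Z|%N < p)%N by lia.
exists (Ordinal ip); rewrite -[x](subrK (ratr r)) /= -addrA.
apply: absD_le; first exact: ltW.
rewrite -[ratr r](subrK w%:~R) -addrA; apply: absD_le; last first.
  rewrite (_ : w%:~R - _ = (w - (w %% p)%Z)%:~R); last first.
    by rewrite intrB; congr (_ - _); rewrite -{2}(gez0_abs (proj1 (andP wm))) -pmulrn.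
  by apply: abs_dvdz; rewrite {1}(divz_eq w p) addrK dvdz_mull.
have d0 : (d%:R : K) != 0 by rewrite natr_neq0 // /d absz_gt0 denq_neq0.
have -> : ratr r - w%:~R = a%:~R * (1 + e * d)%:R / d%:R :> K.
  rewrite rE /w mulrNz opprK intrM natrD natrM -!pmulrn.
  by field.
rewrite !absM absV (abs_coprime pd) invr1 mulr1 -[leRHS]mul1r.
by apply: ler_pM => //; [exact: abs_int_le1 | exact: abs_dvdn].
Qed.

Lemma abs_ord_sub (i j : 'I_p) : absK ((i%:R : K) - j%:R) <= P^-1 -> i = j.
Proof.
wlog ij : i j / (j <= i)%N => [h|].
  by case: (leqP j i) => [/h//|/ltnW/h h']; rewrite absB => /h'.
rewrite -natrB // => h; apply/val_inj/eqP; rewrite eqn_leq ij andbT leqNgt.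
apply/negP => ji; move: h; rewrite leNgt => /negP; apply.
rewrite abs_coprime ?invf_lt1 ?P_gt1 // prime_coprime //.
apply/negP => /dvdn_leq; rewrite subn_gt0 ji => /(_ isT).
by rewrite leqNgt (leq_ltn_trans (leq_subr _ _)).
Qed.

(** * Maximum norms of vectors and matrices *)

Section Norms.
Variable n : nat.
Implicit Types (x y : 'cV[K]_n) (A : 'M[K]_n).

Lemma bigmax_absP (I : finType) (F : I -> R) c :
  0 <= c -> (\big[Num.max/0]_(i : I) F i <= c) <-> (forall i, F i <= c).
Proof.
move=> c0; split => [h i|h]; last by apply/bigmax_leP; split.
by apply: le_trans h; apply: le_bigmax.
Qed.

Lemma vnorm_leP x c : 0 <= c -> vnorm absK x <= c <-> forall j, absK (x j ord0) <= c.
Proof. exact: bigmax_absP. Qed.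

Lemma vnorm_ge x j : absK (x j ord0) <= vnorm absK x.
Proof. exact: le_bigmax. Qed.

Lemma bigmax_ge0 (I : finType) (F : I -> R) : 0 <= \big[Num.max/0]_(i : I) F i.
Proof. exact: bigmax_ge_id. Qed.

Lemma vnorm_ge0 x : 0 <= vnorm absK x. Proof. exact: bigmax_ge0. Qed.
Hint Resolve vnorm_ge0 : core.

Lemma vnorm0 : vnorm absK (0 : 'cV[K]_n) = 0.
Proof.
by apply/eqP; rewrite eq_le vnorm_ge0 andbT; apply/vnorm_leP => // j; rewrite mxE abs0.
Qed.

Lemma vnorm_eq0 x : (vnorm absK x == 0) = (x == 0).
Proof.
apply/eqP/eqP => [x0|->]; last exact: vnorm0.
apply/matrixP => j k; rewrite !mxE ord1; apply/eqP; rewrite -abs_eq0 eq_le abs_ge0 andbT.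
by rewrite -x0 vnorm_ge.
Qed.

Lemma vnorm_gt0 x : (0 < vnorm absK x) = (x != 0).
Proof. by rewrite lt_def vnorm_ge0 andbT vnorm_eq0. Qed.

Lemma vnormD_le x y c : vnorm absK x <= c -> vnorm absK y <= c ->
  vnorm absK (x + y) <= c.
Proof.
move=> xc yc; have c0 := le_trans (vnorm_ge0 x) xc.
apply/vnorm_leP => // j; rewrite mxE; apply: absD_le.
- exact: le_trans (vnorm_ge _ _) xc.
- exact: le_trans (vnorm_ge _ _) yc.
Qed.

Lemma vnormN x : vnorm absK (- x) = vnorm absK x.
Proof. by apply: eq_bigr => j _; rewrite mxE absN. Qed.

Lemma vnormB_le x y c : vnorm absK x <= c -> vnorm absK y <= c ->
  vnorm absK (x - y) <= c.
Proof. by move=> xc yc; apply: vnormD_le; rewrite ?vnormN. Qed.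

Lemma vnormZ c x : vnorm absK (c *: x) = absK c * vnorm absK x.
Proof.
apply/eqP; rewrite eq_le; apply/andP; split.
  apply/vnorm_leP => [|j]; first exact: mulr_ge0.
  by rewrite mxE absM ler_wpM2l // vnorm_ge.
have [->|c0] := eqVneq c 0; first by rewrite abs0 mul0r.
rewrite mulrC -ler_pdivlMr ?abs_gt0 //.
apply/vnorm_leP => [|j]; first by rewrite divr_ge0.
rewrite ler_pdivlMr ?abs_gt0 // mulrC -absM.
by have := vnorm_ge (c *: x) j; rewrite mxE.
Qed.

Lemma bigmax_val (I : finType) (F : I -> R) :
  (forall i, F i = 0 \/ exists k : int, F i = P ^ k) ->
  let M := \big[Num.max/0]_(i : I) F i in M = 0 \/ exists k : int, M = P ^ k.
Proof.
move=> h /=; elim/big_ind : _ => //; first by left.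
by move=> x y hx hy; rewrite /Num.max; case: ifP.
Qed.

Lemma abs_valP (c : K) : absK c = 0 \/ exists k : int, absK c = P ^ k.
Proof.
by have [->|/abs_val] := eqVneq c 0; [left; exact: abs0 | right].
Qed.
Arguments abs_valP : clear implicits.

Lemma vnorm_val x : x != 0 -> exists k : int, vnorm absK x = P ^ k.
Proof.
move=> x0; have [e|//] := bigmax_val (fun j => abs_valP (x j ord0)).
by move: x0; rewrite -vnorm_gt0 /vnorm e ltxx.
Qed.

Lemma mnorm_ge A i j : absK (A i j) <= mnorm absK A.
Proof. apply: le_trans (le_bigmax _ _ i); exact: (le_bigmax _ (fun j => absK (A i j))). Qed.

Lemma mnorm_ge0 A : 0 <= mnorm absK A. Proof. exact: bigmax_ge0. Qed.
Hint Resolve mnorm_ge0 : core.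

Lemma mnorm_leP A c : 0 <= c -> mnorm absK A <= c <-> forall i j, absK (A i j) <= c.
Proof.
move=> c0; rewrite /mnorm bigmax_absP //.
by split=> h i; have := h i; rewrite bigmax_absP.
Qed.

Lemma mnorm_gt0 A : A != 0 -> 0 < mnorm absK A.
Proof.
move=> A0; rewrite lt_def mnorm_ge0 andbT; apply: contraNneq A0 => e.
apply/eqP/matrixP => i j; rewrite mxE; apply/eqP; rewrite -abs_eq0 eq_le abs_ge0 andbT.
by rewrite -e mnorm_ge.
Qed.

Lemma mnorm_val A : A != 0 -> exists k : int, mnorm absK A = P ^ k.
Proof.
move=> A0; have [e|//] := bigmax_val (fun i => bigmax_val (fun j => abs_valP (A i j))).
by move: (mnorm_gt0 A0); rewrite /mnorm e ltxx.
Qed.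

Lemma vnorm_mulmx A x : vnorm absK (A *m x) <= mnorm absK A * vnorm absK x.
Proof.
apply/vnorm_leP => [|i]; first exact: mulr_ge0.
rewrite mxE; apply: abs_sum_le => [|j _]; first exact: mulr_ge0.
by rewrite absM; apply: ler_pM => //; [exact: mnorm_ge | exact: vnorm_ge].
Qed.

End Norms.
End AbsoluteValue.

(** * Measurable maps into Q_p^n *)

Lemma measurable_bigmax d (S : measurableType d) (R : realType) (I : Type)
    (s : seq I) (F : I -> S -> R) :
  (forall i, measurable_fun setT (F i)) ->
  measurable_fun setT (fun x => \big[Num.max/0]_(i <- s) F i x).
Proof.
move=> mF; elim: s => [|i s ih].
  by under eq_fun do rewrite big_nil; exact: measurable_cst.
by under eq_fun do rewrite big_cons; apply: measurable_maxr.
Qed.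

Section Measurability.
Variables (R : realType) (p : nat) (K : fieldType) (absK : K -> R).
Hypotheses (p_pr : prime p) (QpK : is_Qp p absK).
Local Notation P := (p%:R : R).
Let P0 : 0 < P := P_gt0 R p_pr.
Let Pz0 (k : int) : 0 < P ^ k := Pz_gt0 R p_pr k.
Let Pzge0 (k : int) : 0 <= P ^ k := Pz_ge0 R p_pr k.
Let absge0 x : 0 <= absK x := abs_ge0 QpK x.
Hint Resolve P0 Pz0 Pzge0 absge0 : core.

Lemma Pz_archi (e : R) : 0 < e -> exists k : int, P ^ k < e.
Proof.
(* This bounds [e^-1] by a power of 2, and [2 <= p]. *)
move=> e0; have := @upper_nthrootP _ e^-1 _ (leqnn _).
set i := Num.bound _ => ei; exists (- i%:Z).
rewrite -invr_expz invf_plt ?posrE //; apply: lt_le_trans ei _.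
by rewrite lerXn2r ?nnegrE ?ler0n // ler_nat prime_gt1.
Qed.

(** Borel measurability of a [K]-valued map, tested on balls: [K] itself carries no sigma-algebra
    here. *)
Definition Kmeas d (S : measurableType d) (u : S -> K) :=
  forall (c : K) (g : int), measurable [set s | absK (u s - c) <= P ^ g].

Section Kmeas.
Context d (S : measurableType d).
Implicit Types u v : S -> K.

(** Lets a countable union run over a full index type: a numerical side condition empties the
    unwanted members. *)
Lemma measurable_if (b : bool) (A : set S) :
  (b -> measurable A) -> measurable [set s | b /\ A s].
Proof.
case: b => [/(_ isT) mA|_].
  by rewrite (_ : [set s | _] = A) //; apply/seteqP; split => [s []|].
by rewrite (_ : [set s | _] = set0) //; apply/seteqP; split => [s []|].
Qed.

Lemma Kmeas_cst c : Kmeas (fun _ : S => c).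
Proof.
move=> c' g; have := @measurable_if (absK (c - c') <= P ^ g) setT.
by move=> /(_ (fun=> measurableT)); congr measurable; apply/seteqP; split => s //= [].
Qed.

Lemma abs_rat_approx x (g : int) : exists r : rat, absK (x - ratr r) <= P ^ g.
Proof. by have [r /ltW] := Qp_rat_dense QpK x (Pz0 g); exists r. Qed.

(** Choose a rational [r] within [P ^ g] of [u s]. By the ultrametric inequality, [u s + v s] is
    within [P ^ g] of [c] exactly when [v s] is within [P ^ g] of [c - r]. *)
Lemma Kmeas_add u v : Kmeas u -> Kmeas v -> Kmeas (fun s => u s + v s).
Proof.
move=> mu mv c g.
rewrite (_ : [set s | _] = \bigcup_(r : rat)
  ([set s | absK (u s - ratr r) <= P ^ g] `&`
   [set s | absK (v s - (c - ratr r)) <= P ^ g])).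
  apply: countable_bigcupT_measurable => [|r]; first exact: countableP.
  exact: measurableI.
apply/seteqP; split => [s /= h|s [r _ [/= h1 h2]]].
  have [r hr] := abs_rat_approx (u s) g; exists r => //; split => //=.
  rewrite (_ : _ - _ = u s + v s - c - (u s - ratr r)); last by ring.
  exact: (absB_le QpK).
rewrite (_ : _ - _ = (u s - ratr r) + (v s - (c - ratr r))); last by ring.
exact: (absD_le QpK).
Qed.

(** Approximate both factors by rationals [x], [y] up to [P ^ k]. The first three side conditions
    keep the error terms of [expand] below [P ^ g], so that only [x * y - c] matters. *)
Lemma Kmeas_mul u v : Kmeas u -> Kmeas v -> Kmeas (fun s => u s * v s).
Proof.
move=> mu mv c g.
rewrite (_ : [set s | _] = \bigcup_(t : rat * rat * int) [set s |
    [&& P ^ t.2 * absK (ratr t.1.1) <= P ^ g, P ^ t.2 * absK (ratr t.1.2) <= P ^ g,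
        P ^ t.2 * P ^ t.2 <= P ^ g & absK (ratr t.1.1 * ratr t.1.2 - c) <= P ^ g] /\
    ([set s | absK (u s - ratr t.1.1) <= P ^ t.2] `&`
     [set s | absK (v s - ratr t.1.2) <= P ^ t.2]) s]).
  apply: countable_bigcupT_measurable => [|t]; first exact: countableP.
  by apply: measurable_if => _; exact: measurableI.
have expand s (x y : K) : u s * v s - c =
    (x * y - c) + ((u s - x) * y + (v s - y) * x + (u s - x) * (v s - y)) by ring.
apply/seteqP; split => [s /= h|s [[[x y] k] _ /= [/and4P[h1 h2 h3 h4] [h5 h6]]]].
  (* The precision [k] is taken with [P ^ k * m < P ^ (min 0 g)]: it gives [P ^ k <= 1], so the
     approximations stay bounded by [m], and [P ^ k * m <= P ^ g]. *)
  pose m := Num.max 1 (Num.max (absK (u s)) (absK (v s))).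
  have m1 : 1 <= m by rewrite le_max lexx.
  have mgt0 : 0 < m by exact: lt_le_trans m1.
  have [k] := Pz_archi (divr_gt0 (Pz0 (Num.min 0 g)) mgt0).
  rewrite ltr_pdivlMr // => km.
  have kmg : P ^ k * m <= P ^ g.
    by apply: le_trans (ltW km) _; rewrite (le_Pz R p_pr) ge_min lexx orbT.
  have k1 : P ^ k <= 1.
    apply: le_trans (_ : P ^ (Num.min 0 g) <= _); last first.
      by rewrite -(expr0z P) (le_Pz R p_pr) ge_min lexx.
    by apply: le_trans (ltW km); rewrite ler_peMr.
  have [x hx] := abs_rat_approx (u s) k; have [y hy] := abs_rat_approx (v s) k.
  have xm : absK (ratr x) <= m.
    rewrite -(subKr (u s) (ratr x)); apply: (absB_le QpK); first by rewrite !le_max lexx !orbT.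
    exact: le_trans hx (le_trans k1 m1).
  have ym : absK (ratr y) <= m.
    rewrite -(subKr (v s) (ratr y)); apply: (absB_le QpK); first by rewrite !le_max lexx !orbT.
    exact: le_trans hy (le_trans k1 m1).
  have ux : P ^ k * absK (ratr x) <= P ^ g by apply: le_trans kmg; rewrite ler_wpM2l.
  have vy : P ^ k * absK (ratr y) <= P ^ g by apply: le_trans kmg; rewrite ler_wpM2l.
  have kk : P ^ k * P ^ k <= P ^ g.
    by apply: le_trans kmg; rewrite ler_wpM2l // (le_trans k1).
  exists (x, y, k) => //=; split => //; apply/and4P; split => //.
  rewrite -[_ - c](addrK ((u s - ratr x) * ratr y + (v s - ratr y) * ratr x
     + (u s - ratr x) * (v s - ratr y))) -expand.
  apply: (absB_le QpK) => //; do 2?apply: (absD_le QpK); rewrite (absM QpK).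
  - by apply: le_trans vy; rewrite ler_wpM2r.
  - by apply: le_trans ux; rewrite ler_wpM2r.
  - by apply: le_trans kk; apply: ler_pM.
rewrite (expand s (ratr x) (ratr y)).
apply: (absD_le QpK) => //; do 2?apply: (absD_le QpK); rewrite (absM QpK).
- by apply: le_trans h2; rewrite ler_wpM2r.
- by apply: le_trans h1; rewrite ler_wpM2r.
- by apply: le_trans h3; apply: ler_pM.
Qed.

Lemma Kmeas_sum (I : Type) (r : seq I) (Q : pred I) (F : I -> S -> K) :
  (forall i, Kmeas (F i)) -> Kmeas (fun s => \sum_(i <- r | Q i) F i s).
Proof.
move=> mF; elim: r => [|i r ih].
  by under eq_fun do rewrite big_nil; exact: Kmeas_cst.
under eq_fun do rewrite big_cons.
by case: (Q i) => //; apply: Kmeas_add.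
Qed.

Lemma Kmeas_prod (I : Type) (r : seq I) (Q : pred I) (F : I -> S -> K) :
  (forall i, Kmeas (F i)) -> Kmeas (fun s => \prod_(i <- r | Q i) F i s).
Proof.
move=> mF; elim: r => [|i r ih].
  by under eq_fun do rewrite big_nil; exact: Kmeas_cst.
under eq_fun do rewrite big_cons.
by case: (Q i) => //; apply: Kmeas_mul.
Qed.

Lemma Kmeas_det n (A : S -> 'M[K]_n) :
  (forall i j, Kmeas (fun s => A s i j)) -> Kmeas (fun s => \det (A s)).
Proof.
move=> mA; apply: Kmeas_sum => s; apply: Kmeas_mul; first exact: Kmeas_cst.
by apply: Kmeas_prod.
Qed.

Lemma Kmeas_adj n (A : S -> 'M[K]_n) i j :
  (forall i j, Kmeas (fun s => A s i j)) -> Kmeas (fun s => (\adj (A s)) i j).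
Proof.
move=> mA; under eq_fun do rewrite mxE /cofactor.
apply: Kmeas_mul; first exact: Kmeas_cst.
apply: Kmeas_det => k l.
have := mA (lift j k) (lift i l).
by congr Kmeas; apply/funext => s; rewrite !mxE.
Qed.

(** As the absolute value takes only the value 0 and powers of [P], the set [|u| < x] is the union
    of the sets [|u| <= P ^ k] over [P ^ k < x]. *)
Lemma measurable_absK u : Kmeas u -> measurable_fun setT (absK \o u).
Proof.
move=> mu _; apply: (measurability _ (RGenInftyO.measurableE R)) => //.
move=> _ [_ [x ->] <-]; rewrite setTI.
rewrite (_ : _ @^-1` _ =
  \bigcup_(k : int) [set s | (P ^ k < x) /\ [set s | absK (u s - 0) <= P ^ k] s]).
  apply: countable_bigcupT_measurable => [|k]; first exact: countableP.
  by apply: (@measurable_if (P ^ k < x)).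
apply/seteqP; split => [s /=|s [k _ /= []]]; rewrite in_itv /= ?subr0.
  move=> ux; have [k /= kx] : exists k : int, P ^ k < x /\ absK (u s) <= P ^ k.
    have [us0|[k uk]] := abs_valP p_pr QpK (u s); last by exists k; rewrite -uk.
    rewrite us0 in ux *; have [k kx] := Pz_archi ux.
    by exists k.
  by exists k => //=; rewrite subr0.
by move=> kx uk; exact: le_lt_trans kx.
Qed.

Lemma measurable_mnorm n (A : S -> 'M[K]_n) :
  (forall i j, Kmeas (fun s => A s i j)) ->
  measurable_fun setT (fun s => mnorm absK (A s)).
Proof.
move=> mA; apply: measurable_bigmax => i; apply: measurable_bigmax => j.
exact: measurable_absK.
Qed.

End Kmeas.

Lemma Kmeas_comp d d' (S : measurableType d) (S' : measurableType d')
    (u : S -> K) (phi : S' -> S) :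
  measurable_fun setT phi -> Kmeas u -> Kmeas (u \o phi).
Proof.
move=> mphi mu c g; rewrite -[X in measurable X]setTI.
exact: (mphi measurableT _ (mu c g)).
Qed.

Local Notation T n := (Qpn p absK n).

Lemma measurable_closed_Qball n (c : 'cV[K]_n) (g : int) :
  measurable ([set x | vnorm absK (x - c) <= P ^ g] : set (T n)).
Proof. by apply: sub_sigma_algebra; exists c, g. Qed.

Lemma measurable_Bg n g : measurable (Bg p absK n g).
Proof.
have := @measurable_closed_Qball n 0 g; congr measurable.
by apply/seteqP; split => x /=; rewrite subr0.
Qed.

(** A condition on one coordinate defines a cylinder, not a ball. It is covered by the balls of
    radius [P ^ g] around rational points whose [j]-th coordinate is near [c]. *)
Lemma Kmeas_coord n (j : 'I_n) : Kmeas (fun x : T n => (x : 'cV[K]_n) j ord0).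
Proof.
move=> c g.
rewrite (_ : [set s | _] = \bigcup_(r : {ffun 'I_n -> rat}) [set x : T n |
  absK (ratr (r j) - c) <= P ^ g /\
  [set x : T n | vnorm absK ((x : 'cV[K]_n) - \col_i ratr (r i)) <= P ^ g] x]).
  apply: countable_bigcupT_measurable => [|r]; first exact: countableP.
  by apply: (@measurable_if _ _ (_ <= _)) => _; exact: measurable_closed_Qball.
apply/seteqP; split => [x /= h|x [r _ /= [h1 h2]]].
  have /choice [r hr] : forall i, exists r : rat,
      absK ((x : 'cV[K]_n) i ord0 - ratr r) <= P ^ g.
    by move=> i; exact: abs_rat_approx.
  exists (finfun r) => //=; split.
    rewrite ffunE -(subKr ((x : 'cV[K]_n) j ord0) (ratr (r j))) addrAC.
    exact: (absB_le QpK).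
  by apply/vnorm_leP => // i; rewrite !mxE ffunE.
rewrite -[_ - c](subrKA (ratr (r j))); apply: (absD_le QpK) => //.
by have /vnorm_leP := h2; move=> /(_ (Pzge0 g) j); rewrite !mxE.
Qed.

Lemma measurable_vec d (S : measurableType d) n (v : S -> T n) :
  (forall j, Kmeas (fun s => (v s : 'cV[K]_n) j ord0)) -> measurable_fun setT v.
Proof.
move=> mv; apply: (@measurability _ _ S (T n) setT v (Qp_balls p absK n)) => // _ [_ [c [g ->]] <-].
rewrite setTI (_ : _ @^-1` _ = \bigcap_(j : 'I_n)
   [set s | absK ((v s : 'cV[K]_n) j ord0 - c j ord0) <= P ^ g]).
  by apply: fin_bigcap_measurable => // j _; exact: mv.
apply/seteqP; split => [s /= h j _ /=|s h /=].
  by have /vnorm_leP := h; move=> /(_ (Pzge0 g) j); rewrite !mxE.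
by apply/vnorm_leP => // j; rewrite !mxE; exact: h.
Qed.

(** Translates the measurability hypothesis of the theorem, where a matrix entry is viewed as a
    vector of length 1. *)
Lemma Kmeas_of_const_mx d (S : measurableType d) (u : S -> K) :
  measurable_fun setT (fun s => (const_mx (u s) : T 1)) -> Kmeas u.
Proof.
move=> mu; have := Kmeas_comp mu (@Kmeas_coord 1 ord0).
by rewrite /comp /=; under eq_fun do rewrite mxE.
Qed.

Lemma measurable_vnorm n : measurable_fun setT (fun x : T n => vnorm absK (x : 'cV[K]_n)).
Proof.
by apply: measurable_bigmax => j; apply: measurable_absK; exact: Kmeas_coord.
Qed.

Lemma measurable_mulmx d (S : measurableType d) n (A : S -> 'M[K]_n) (x : S -> T n) :
  (forall i j, Kmeas (fun s => A s i j)) -> measurable_fun setT x ->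
  measurable_fun setT (fun s => (A s *m (x s : 'cV[K]_n) : T n)).
Proof.
move=> mA mx; apply: measurable_vec => j; under eq_fun do rewrite mxE.
apply: Kmeas_sum => k; apply: Kmeas_mul => //.
exact: Kmeas_comp mx (@Kmeas_coord n k).
Qed.

Lemma measurable_pw n a : measurable_fun setT (@pw R p K absK n a).
Proof.
apply: (measurableT_comp (measurable_powR a)); exact: measurable_vnorm.
Qed.

End Measurability.

(** * The modulus of a matrix *)

Section Modulus.
Variables (R : realType) (p : nat) (K : fieldType) (absK : K -> R).
Hypotheses (p_pr : prime p) (QpK : is_Qp p absK).
Variables (n : nat) (d : 'M[K]_n.+1 -> R).
Local Notation P := (p%:R : R).
Implicit Types A B V U D : 'M[K]_n.+1.
Hypothesis d_ge0 : forall A, 0 <= d A.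
Hypothesis dM : forall A B, A \in unitmx -> B \in unitmx -> d (A *m B) = d A * d B.
Hypothesis d_integral : forall V,
  (forall i j, absK (V i j) <= 1) -> absK (\det V) = 1 -> d V = 1.
Hypothesis d_scalar : d (p%:R%:M) = P ^+ n.+1.

Let d1 : d 1%:M = 1.
Proof.
apply: d_integral => [i j|]; last by rewrite det1 (abs1 QpK).
by rewrite mxE (abs_nat QpK).
Qed.

Let d_conj A B : A \in unitmx -> B \in unitmx -> d (A *m B *m invmx A) = d B.
Proof.
move=> uA uB; rewrite !dM ?unitmx_mul ?unitmx_inv ?uA // mulrAC -dM ?unitmx_inv //.
by rewrite mulmxV // d1 mul1r.
Qed.

(* Conjugating by a diagonal matrix with very unequal entries makes the
   off-diagonal part of a unipotent matrix integral. *)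
Let d_unipotent (w : 'I_n.+1 -> nat) U : \det U = 1 -> (forall i, U i i = 1) ->
  (forall i j, i != j -> (w j <= w i)%N -> U i j = 0) -> d U = 1.
Proof.
move=> dU U1 U0; have uU : U \in unitmx by rewrite unitmxE dU unitr1.
have m0 : 0 < mnorm absK U + 1 by rewrite ltr_pwDr // mnorm_ge0.
have [k] := Pz_archi p_pr (divr_gt0 ltr01 m0); rewrite ltr_pdivlMr // => hk.
have P0 := P_gt0 R p_pr; have Pk0 := Pz_ge0 R p_pr k.
have k1 : P ^ k <= 1.
  by apply: le_trans (ltW hk); rewrite ler_peMr // lerDr mnorm_ge0.
have k0 : k <= 0 by rewrite -(le_Pz R p_pr) expr0z.
pose t := \row_i ((p%:R : K) ^ (k * (w i)%:Z)).
have t0 i : t 0 i != 0 by rewrite mxE expfz_neq0 // (pK_neq0 p_pr QpK).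
have uD : diag_mx t \in unitmx.
  by rewrite unitmxE det_diag unitfE; apply/prodf_neq0 => i _.
have DV : invmx (diag_mx t) = diag_mx (map_mx (@GRing.inv K) t).
  apply: (can_inj (mulKmx uD)); rewrite mulmxV // mulmx_diag -[1%:M]diag_const_mx.
  by congr diag_mx; apply/rowP => i; rewrite !mxE; have := t0 i; rewrite mxE => /divff.
rewrite -(d_conj uD uU); apply: d_integral; last first.
  by rewrite !det_mulmx dU mulr1 -det_mulmx mulmxV // det1 (abs1 QpK).
move=> i j; rewrite DV mul_mx_diag mul_diag_mx !mxE.
have [<-|ij] := eqVneq i j.
  by rewrite U1 mulr1; have := t0 i; rewrite mxE => /divff ->; rewrite (abs1 QpK).
have [wij|wij] := leqP (w j) (w i).
  by rewrite U0 // mulr0 mul0r (abs0 QpK).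
rewrite !(absM QpK) (absV QpK) !(absP QpK) mulrAC invr_expz opprK -(PzD R p_pr).
apply: le_trans (_ : P ^ k * (mnorm absK U + 1) <= _); last exact: ltW.
apply: ler_pM; rewrite ?(Pz_ge0 R p_pr) ?(abs_ge0 QpK) //.
  by rewrite (le_Pz R p_pr); nia.
by apply: le_trans (mnorm_ge _ _ _ _) _; rewrite lerDl.
Qed.

Let E i (t : K) : 'M[K]_n.+1 := diag_mx (\row_j (if j == i then t else 1)).

Let EM i s t : E i (s * t) = E i s *m E i t.
Proof.
rewrite mulmx_diag; congr diag_mx; apply/rowP => j; rewrite !mxE.
by case: ifP => _; rewrite ?mulr1.
Qed.

Let detE i t : \det (E i t) = t.
Proof.
rewrite det_diag (bigD1 i) //= mxE eqxx big1 ?mulr1 // => j /negPf ji.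
by rewrite mxE ji.
Qed.

Let uE i t : t != 0 -> E i t \in unitmx.
Proof. by move=> t0; rewrite unitmxE detE unitfE. Qed.

Let d_prod (I : Type) (r : seq I) (F : I -> 'M[K]_n.+1) :
  (forall i, F i \in unitmx) -> \prod_(i <- r) F i \in unitmx /\
  d (\prod_(i <- r) F i) = \prod_(i <- r) d (F i).
Proof.
move=> uF; elim: r => [|i r [u ih]]; first by rewrite !big_nil unitmx1 d1.
by rewrite !big_cons dM // ih unitmx_mul uF u.
Qed.

Let diag_prod (I : Type) (r : seq I) (F : I -> 'rV[K]_n.+1) :
  \prod_(i <- r) diag_mx (F i) = diag_mx (\row_j \prod_(i <- r) F i 0 j).
Proof.
elim: r => [|i r ih].
  rewrite big_nil -[1]diag_const_mx; congr diag_mx.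
  by apply/rowP => j; rewrite !mxE big_nil.
rewrite big_cons ih [_ * _]mulmx_diag; congr diag_mx.
by apply/rowP => j; rewrite !mxE big_cons.
Qed.

Let prod_E (t : 'rV[K]_n.+1) : \prod_i E i (t 0 i) = diag_mx t.
Proof.
rewrite diag_prod; congr diag_mx; apply/rowP => j; rewrite mxE.
rewrite (bigD1 j) //= mxE eqxx big1 ?mulr1 // => i.
by rewrite mxE eq_sym => /negPf ->.
Qed.

Let d_tperm i j : d (tperm_mx i j) = 1.
Proof.
apply: d_integral => [k l|]; first by rewrite !mxE (abs_nat QpK).
rewrite det_perm; case: (odd_perm _); rewrite ?expr1 ?expr0 ?(absN QpK); exact: abs1 QpK.
Qed.

(** Transpositions conjugate the [E i p] into each other, so they share one value. Their product is
    the scalar matrix [p], so the [n.+1]-th power of this value is [P ^+ n.+1]. *)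
Let dE_p i : d (E i p%:R) = P.
Proof.
have pK := pK_neq0 p_pr QpK.
have eq_ij j : d (E j p%:R) = d (E i p%:R).
  have ut : tperm_mx i j \in @unitmx K n.+1 by exact: unitmx_perm.
  rewrite -(mulr1 (d (E j _))) -(d_tperm i j) -dM ?uE //.
  rewrite -[RHS]mul1r -[X in X * d (E i _)](d_tperm i j) -dM ?uE //; congr d.
  rewrite -xrowE -xcolE; apply/matrixP => k l; rewrite !mxE.
  have -> : (k == tperm i j l) = (tperm i j k == l).
    by rewrite -(inj_eq (@perm_inj _ (tperm i j))) tpermK.
  have -> : (tperm i j k == i) = (k == j).
    by rewrite -[X in _ == X](tpermR i j) (inj_eq perm_inj).
  by [].
have : P ^+ n.+1 = d (E i p%:R) ^+ n.+1.
  rewrite -d_scalar -diag_const_mx -prod_E.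
  rewrite (eq_bigr (fun i => E i p%:R)) => [|j _]; last by rewrite mxE.
  have [_ ->] := @d_prod _ (index_enum 'I_n.+1) (fun i => E i p%:R) (fun i => uE i pK).
  by rewrite (eq_bigr (fun=> d (E i p%:R))) // prodr_const card_ord.
move=> /eqP; rewrite eqrXn2 ?ler0n // => /eqP e; exact: esym.
Qed.

Let dE_unit i t : absK t = 1 -> d (E i t) = 1.
Proof.
move=> t1; apply: d_integral; last by rewrite detE.
move=> k l; rewrite mxE; case: eqP => _; last by rewrite mulr0n (abs0 QpK).
by rewrite mulr1n mxE; case: ifP => _; rewrite ?t1 // (abs1 QpK).
Qed.

(** If [|t| = P ^ k], then [t] is the unit [t * p ^ k] times [p ^ (- k)]. *)
Let dE i t : t != 0 -> d (E i t) = (absK t)^-1.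
Proof.
have pK := pK_neq0 p_pr QpK.
have powp (k : nat) : d (E i (p%:R ^+ k)) = P ^+ k.
  elim: k => [|k ih]; first by rewrite dE_unit // (abs1 QpK).
  by rewrite !exprS EM dM ?uE ?expf_neq0 // dE_p ih.
have powz (k : int) : d (E i (p%:R ^ k)) = P ^ k.
  case: k => k; first exact: powp.
  have u : (p%:R : K) ^ Negz k != 0 by rewrite expfz_neq0.
  have /mulfI : (P ^+ k.+1) != 0 by rewrite expf_neq0 // (P_neq0 R p_pr).
  apply; rewrite -{1}powp -dM ?uE ?expf_neq0 // -EM NegzE -!exprnN.
  by rewrite !divff ?expf_neq0 ?(P_neq0 R p_pr) // dE_unit // (abs1 QpK).
move=> t0; have [k tk] := abs_val p_pr QpK t0; rewrite tk.
rewrite -[t](mulfK (expfz_neq0 k pK)) EM [(p%:R ^ k)^-1]invr_expz dM ?uE ?mulf_neq0 ?expfz_neq0 //.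
rewrite powz dE_unit ?mul1r ?invr_expz // (absM QpK) (absP QpK) tk -(PzD R p_pr) subrr.
exact: expr0z.
Qed.

(** Dividing each row by its diagonal entry leaves a unipotent matrix, of value 1. The diagonal part
    splits into the matrices [E i]. *)
Let d_upper U : (forall i j : 'I_n.+1, (j < i)%N -> U i j = 0) -> U \in unitmx ->
  d U = (absK (\det U))^-1.
Proof.
move=> U0 uU; have detU : \det U = \prod_i U i i.
  rewrite -det_tr det_trig; first by apply: eq_bigr => i _; rewrite mxE.
  by apply/is_trig_mxP => i j ij; rewrite mxE U0.
have Uii i : U i i != 0.
  move: uU; rewrite unitmxE detU unitfE => /prodf_neq0; exact.
pose t := \row_i U i i; pose V := diag_mx (map_mx (@GRing.inv K) t) *m U.
have UV : U = diag_mx t *m V.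
  apply/matrixP => i j; rewrite /V !mul_diag_mx !mxE mulrA divff ?mul1r //.
have Vi i : V i i = 1 by rewrite /V mul_diag_mx !mxE mulVf.
have V0 (i j : 'I_n.+1) : (j < i)%N -> V i j = 0.
  by move=> ji; rewrite /V mul_diag_mx !mxE (U0 i j) // mulr0.
have detV : \det V = 1.
  rewrite /V det_mulmx det_diag detU -big_split big1 //= => i _.
  by rewrite !mxE mulVf.
have uV : V \in unitmx by rewrite unitmxE detV unitr1.
have -> : d U = d (diag_mx t).
  rewrite UV dM //; last first.
    by rewrite unitmxE det_diag unitfE; apply/prodf_neq0 => i _; rewrite mxE.
  rewrite (@d_unipotent (fun i => i : nat) V) ?mulr1 // => i j ij ji.
  by rewrite V0 // ltn_neqAle ji andbT eq_sym; apply: contra_neq ij => /ord_inj.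
rewrite -prod_E detU (abs_prod QpK) -prodfV.
have uF i : E i (t 0 i) \in unitmx by rewrite uE // mxE.
have [_ ->] := d_prod (index_enum 'I_n.+1) uF.
by apply: eq_bigr => i _; rewrite dE mxE.
Qed.

(** In the application [d A] is the measure of the preimage of the unit ball under [A], hence the
    inverse. In the LUP decomposition only the upper factor has a value other than 1, and it carries
    [det A] up to sign. *)
Lemma modulusE A : A \in unitmx -> d A = (absK (\det A))^-1.
Proof.
move=> uA; have := cormen_lup_correct A; have := cormen_lup_perm A.
have := cormen_lup_detL A; have := cormen_lup_lower A; have := cormen_lup_upper A.
case: (cormen_lup A) => [[Q L] U] /= U0 L0 dL /is_perm_mxP [s ->] PA.
have dP : absK (\det (perm_mx s)) = 1.
  rewrite det_perm; case: (odd_perm _); rewrite ?expr1 ?expr0 ?(absN QpK); exact: abs1 QpK.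
have dQ : d (perm_mx s) = 1.
  by apply: d_integral => // k l; rewrite !mxE (abs_nat QpK).
have uL : L \in unitmx by rewrite unitmxE dL unitr1.
have uU : U \in unitmx.
  have : perm_mx s *m A \in unitmx by rewrite unitmx_mul unitmx_perm.
  by rewrite [_ *m _]PA unitmx_mul => /andP[].
have L1 : d L = 1.
  (* The weights decrease in [i], because the nonzero entries now lie below the diagonal. *)
  apply: (@d_unipotent (fun i => (n - i)%N)) => // [i|i j ij].
    by rewrite L0 // eqxx.
  move=> h; rewrite L0 ?(negPf ij) //.
  by have := ltn_ord i; have := ltn_ord j; lia.
have -> : d A = d U.
  by rewrite -[LHS]mul1r -dQ -dM ?unitmx_perm // [_ *m _]PA dM // L1 mul1r.
rewrite d_upper //; congr (_^-1).
have := congr1 (absK \o determinant) PA => /=.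
by rewrite !det_mulmx !(absM QpK) dP dL (abs1 QpK) !mul1r.
Qed.

End Modulus.

(** * Haar measure *)

Definition image_measure d d' (S : measurableType d) (S' : measurableType d')
    (R : realType) (m : {measure set S -> \bar R}) (f : S -> S')
    (mf : measurable_fun setT f) : {measure set S' -> \bar R} :=
  @measure_function_pushforward__canonical__measure_function_Measure _ _ _ _ _ m f mf.

Section Haar.
Variables (R : realType) (p : nat) (K : fieldType) (absK : K -> R).
Hypotheses (p_pr : prime p) (QpK : is_Qp p absK).
Local Notation P := (p%:R : R).
Let P0 : 0 < P := P_gt0 R p_pr.
Let Pn0 : P != 0 := P_neq0 R p_pr.
Let Pz0 (k : int) : 0 < P ^ k := Pz_gt0 R p_pr k.
Let Pzge0 (k : int) : 0 <= P ^ k := Pz_ge0 R p_pr k.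
Let absge0 x : 0 <= absK x := abs_ge0 QpK x.
Hint Resolve P0 Pn0 Pz0 Pzge0 absge0 : core.
Variable n' : nat.
Local Notation n := n'.+1.
Local Notation T := (Qpn p absK n).

Definition Qball (c : 'cV[K]_n) (g : int) : set T :=
  [set x : T | vnorm absK ((x : 'cV[K]_n) - c) <= P ^ g].

Lemma Qball0 g : Qball 0 g = Bg p absK n g.
Proof. by apply/seteqP; split => x; rewrite /Qball /= subr0. Qed.

Lemma measurable_Qball c g : measurable (Qball c g).
Proof. exact: measurable_closed_Qball. Qed.
Hint Resolve measurable_Qball : core.

Lemma Qball_center c c' g x : Qball c g x -> Qball c' g x -> Qball c g = Qball c' g.
Proof.
have sub c1 c2 : Qball c1 g x -> Qball c2 g x -> Qball c1 g `<=` Qball c2 g.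
  move=> h1 h2 y h; rewrite /Qball /= -[_ - c2](subrKA (x : 'cV[K]_n)).
  apply: (vnormD_le QpK) => //; rewrite -[_ - _](subrKA c1).
  by apply: (vnormD_le QpK) => //; rewrite -[c1 - _]opprB (vnormN QpK).
by move=> h1 h2; apply/seteqP; split; exact: sub.
Qed.

Lemma Qball_le c g g' : g <= g' -> Qball c g `<=` Qball c g'.
Proof. by move=> gg x; rewrite /Qball /= => /le_trans; apply; rewrite (le_Pz R p_pr). Qed.

(** With the empty set added, the balls thus form a pi-system, as uniqueness of measures
    requires. *)
Lemma Qball_setI c c' g g' : g <= g' ->
  Qball c g `&` Qball c' g' = set0 \/ Qball c g `&` Qball c' g' = Qball c g.
Proof.
move=> gg; have [->|/set0P[x [h h']]] := eqVneq (Qball c g `&` Qball c' g') set0; [by left|right].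
apply: setIidl; rewrite (Qball_center h' (Qball_le gg h)); exact: Qball_le.
Qed.

(** Dividing by [p ^ (- (g + 1))], of absolute value [P ^ (g + 1)], turns the large ball into the
    unit ball. The residues of the coordinates index the [p ^ n] pieces. *)
Lemma Qball_bigcup g : Qball 0 (g + 1) =
  \bigcup_(a in [set` index_enum {ffun 'I_n -> 'I_p}])
     Qball ((p%:R : K) ^ (- (g + 1)) *: \col_i (a i)%:R) g.
Proof.
have pK : (p%:R : K) ^ (- (g + 1)) != 0 by rewrite expfz_neq0 // (pK_neq0 p_pr QpK).
set u := _ ^ _ in pK *; have au : absK u = P ^ (g + 1) by rewrite (absP QpK) opprK.
apply/seteqP; split => x; rewrite /Qball /=.
  rewrite subr0 => /(vnorm_leP _ _ (Pzge0 _)) hx.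
  have /choice [a ha] : forall i, exists k : 'I_p,
      absK ((x : 'cV[K]_n) i 0 / u - k%:R) <= P^-1.
    move=> i; apply: (abs_residue p_pr QpK).
    by rewrite (absM QpK) (absV QpK) au ler_pdivrMr // mul1r.
  exists (finfun a); first by rewrite /= mem_index_enum.
  apply/(vnorm_leP _ _ (Pzge0 _)) => i; rewrite !mxE ffunE.
  have -> : (x : 'cV[K]_n) i 0 - u * (a i)%:R = u * ((x : 'cV[K]_n) i 0 / u - (a i)%:R).
    by field.
  rewrite (absM QpK) au; apply: le_trans (ler_wpM2l (Pzge0 _) (ha i)) _.
  by rewrite (PzD R p_pr) expr1z mulfK.
case=> a _ hx; rewrite subr0 -[x : 'cV[K]_n](subrK (u *: \col_i (a i)%:R)).
apply: (vnormD_le QpK).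
  by apply: le_trans hx _; rewrite (le_Pz R p_pr) lerDl.
apply/(vnorm_leP _ _ (Pzge0 _)) => i; rewrite !mxE (absM QpK) au.
by rewrite ler_piMr // (abs_nat QpK).
Qed.

Lemma Qball_trivIset g (D : set {ffun 'I_n -> 'I_p}) :
  trivIset D (fun a => Qball ((p%:R : K) ^ (- (g + 1)) *: \col_i (a i)%:R) g).
Proof.
move=> a b _ _ [x [ha hb]]; apply/ffunP => i; apply: (abs_ord_sub p_pr QpK).
have pK : (p%:R : K) ^ (- (g + 1)) != 0 by rewrite expfz_neq0 // (pK_neq0 p_pr QpK).
set u := _ ^ _ in pK ha hb; have au : absK u = P ^ (g + 1) by rewrite (absP QpK) opprK.
have := vnormB_le QpK hb ha; move=> /(vnorm_leP _ _ (Pzge0 _))/(_ i); rewrite !mxE.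
rewrite (_ : _ - _ = u * ((a i)%:R - (b i)%:R)); last by ring.
rewrite (absM QpK) au -ler_pdivlMl //.
by rewrite invr_expz -(PzD R p_pr) (_ : _ + g = -1) //; ring.
Qed.

(** * Measures giving equal mass to all balls of equal radius *)

Section BallInvariant.
Variable nu : {measure set T -> \bar R}.
Hypothesis nu_ball : forall c g, nu (Qball c g) = nu (Qball 0 g).

Lemma invariant_ball_succ g : nu (Qball 0 (g + 1)) = ((P ^+ n)%:E * nu (Qball 0 g))%E.
Proof.
rewrite Qball_bigcup measure_fin_bigcup //; last exact: Qball_trivIset.
rewrite -fsbig_seq ?index_enum_uniq //.
rewrite (eq_bigr (fun=> nu (Qball 0 g))) => [|a _]; last exact: nu_ball.
rewrite sumr_const card_ffun !card_ord.
by rewrite -natrX mule_natl.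
Qed.

Lemma invariant_Qball c g : nu (Qball c g) = (((P ^ g) ^+ n)%:E * nu (Qball 0 0))%E.
Proof.
have up (k : nat) h : nu (Qball 0 (h + k%:Z)) = ((((P ^+ k) ^+ n))%:E * nu (Qball 0 h))%E.
  elim: k => [|k ih]; first by rewrite addr0 expr0 expr1n mul1e.
  rewrite -(addn1 k) PoszD addrA invariant_ball_succ ih muleA -EFinM; congr (_%:E * _)%E.
  by rewrite -exprMn -exprS addn1.
rewrite nu_ball; case: g => k; first by have := up k 0; rewrite add0r.
(* For a negative radius exponent, climb up to the unit ball and divide. *)
have := up k.+1 (Negz k); rewrite NegzE addNr => ->.
rewrite muleA -EFinM -exprMn -exprnN mulVf ?expr1n ?mul1e //.
by rewrite expf_neq0.
Qed.

End BallInvariant.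

Variable mu : {measure set T -> \bar R}.
Hypothesis haar : is_Haar mu.

Lemma haar_translate a (A : set T) : measurable A ->
  mu [set x : T | A ((x : 'cV[K]_n) + a)] = mu A.
Proof.
move=> mA; rewrite -(haar.1 (- a) A mA); congr (mu _); apply/seteqP; split => [x /= Ax|].
  by exists ((x : 'cV[K]_n) + a) => //; rewrite addrK.
by move=> _ [y Ay <-] /=; rewrite subrK.
Qed.

Lemma haar_Qball c g : mu (Qball c g) = ((P ^ g) ^+ n)%:E.
Proof.
rewrite invariant_Qball; first by rewrite Qball0 haar.2 mule1.
move=> {}c {}g; rewrite -(haar_translate c (measurable_Qball _ _)); congr (mu _).
by apply/seteqP; split => x; rewrite /Qball /= addrK subr0.
Qed.

(** Invariance is asked on balls only, which is easy to check for image measures. Subdivision into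
    [p ^ n] pieces fixes the mass of every ball, and the balls form a generating pi-system that
    exhausts the space. *)
Lemma haar_unique (nu : {measure set T -> \bar R}) (r : R) : 0 <= r ->
  (forall c g, nu (Qball c g) = nu (Qball 0 g)) -> nu (Qball 0 0) = r%:E ->
  forall A, measurable A -> nu A = (r%:E * mu A)%E.
Proof.
move=> r0 nu_ball nur; pose m := mscale (NngNum r0) mu.
pose G : set (set T) := [set A | A = set0 \/ exists c g, A = Qball c g].
have GE : measurable = <<s G >>.
  rewrite [LHS](_ : _ = <<s Qp_balls p absK n >>) //; apply/seteqP; split.
    by apply: sub_smallest2r; [exact: smallest_sigma_algebra | move=> _ [c [g ->]]; right; exists c, g].
  apply: smallest_sub; first exact: smallest_sigma_algebra.
  by move=> A [->|[c [g ->]]]; [exact: (@measurable0 _ T) | exact: measurable_Qball].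
apply: (measure_unique G (fun k : nat => Qball 0 k%:Z) GE _ _ _ nu m).
- move=> _ _ [->|[c [g ->]]] [->|[c' [g' ->]]]; rewrite ?set0I ?setI0; try by left.
  have [gg|/ltW gg] := leP g g'.
    by have [->|->] := Qball_setI c c' gg; [left|right; exists c, g].
  by rewrite setIC; have [->|->] := Qball_setI c' c gg; [left|right; exists c', g'].
- by move=> k; right; exists 0, k%:Z.
- apply/seteqP; split => // x _.
  have [->|x0] := eqVneq (x : 'cV[K]_n) 0.
    by exists 0%N => //; rewrite /Qball /= subr0 (vnorm0 QpK).
  have [k kx] := vnorm_val p_pr QpK x0.
  exists `|k|%N => //; rewrite /Qball /= subr0 kx (le_Pz R p_pr); lia.
- move=> A [->|[c [g ->]]]; first by rewrite !measure0.
  transitivity (r%:E * mu (Qball c g))%E; last by [].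
  by rewrite haar_Qball (invariant_Qball nu_ball) nur muleC.
- by move=> k; rewrite (invariant_Qball nu_ball) nur -EFinM ltry.
Qed.

Definition mulmxT (A : 'M[K]_n) : T -> T := fun x => (A *m (x : 'cV[K]_n) : T).

Lemma measurable_mulmxT A : measurable_fun setT (mulmxT A).
Proof.
by apply: (measurable_mulmx p_pr QpK) => // i j; exact: Kmeas_cst.
Qed.

Let pre A E : measurable E -> measurable (mulmxT A @^-1` E).
Proof. by move=> mE; rewrite -[X in measurable X]setTI; exact: measurable_mulmxT. Qed.

Let d A : R := fine (mu (mulmxT A @^-1` Qball 0 0)).

(** The content is finiteness: the preimage lies in the ball of radius [||A^-1||]. *)
Let dE A : A \in unitmx -> mu (mulmxT A @^-1` Qball 0 0) = (d A)%:E.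
Proof.
move=> uA; rewrite /d fineK // ge0_fin_numE ?measure_ge0 //.
have [k hk] : exists k : int, mnorm absK (invmx A) <= P ^ k.
  have A0 : invmx A != 0.
    by apply: contraTneq uA => A0; rewrite -unitmx_inv A0 unitmxE det0 unitr0.
  by have [k ->] := mnorm_val p_pr QpK A0; exists k.
apply: le_lt_trans (_ : (mu (Qball 0 k) < +oo)%E); last by rewrite haar_Qball ltry.
apply: le_measure; rewrite ?inE //; first exact: pre.
move=> x; rewrite /Qball /= !subr0 /mulmxT => Ax.
rewrite -[x : 'cV[K]_n](mulKmx uA); apply: le_trans (vnorm_mulmx QpK _ _) _.
by rewrite -[leRHS]mulr1; apply: ler_pM => //; [exact: mnorm_ge0 | exact: vnorm_ge0].
Qed.

(** The preimage of a ball around [c] is a translate, by [A^-1 c], of the preimage of the centred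
    ball, so uniqueness applies to the image of [mu] under [A]. *)
Let mu_pre A E : A \in unitmx -> measurable E ->
  mu (mulmxT A @^-1` E) = ((d A)%:E * mu E)%E.
Proof.
move=> uA mE; apply: (@haar_unique (image_measure mu (measurable_mulmxT A))) => //=.
- by rewrite /d fine_ge0 // measure_ge0.
- move=> c g; rewrite /pushforward.
  rewrite -(haar_translate (invmx A *m c) (pre A (measurable_Qball c g))); congr (mu _).
  by apply/seteqP; split => x; rewrite /Qball /= /mulmxT mulmxDr mulKVmx // addrK subr0.
- exact: dE.
Qed.

Lemma haar_preimage A E : A \in unitmx -> measurable E ->
  mu (mulmxT A @^-1` E) = ((absK (\det A))^-1%:E * mu E)%E.
Proof.
move=> uA mE; rewrite mu_pre //; congr (_%:E * _)%E.
apply: (modulusE p_pr QpK (d := d)) => //.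
- by move=> B; rewrite /d fine_ge0 // measure_ge0.
- move=> B C uB uC; apply: EFin_inj; rewrite -dE ?unitmx_mul ?uB // EFinM -(dE uB) muleC.
  rewrite -mu_pre //; last exact: pre.
  by congr (mu _); apply/seteqP; split => x; rewrite /mulmxT /= mulmxA.
(* The inverse of [V] is its adjugate over a unit, hence integral as well, and [V] maps the unit
   ball onto itself. *)
- move=> V V1 dV; rewrite /d (_ : _ @^-1` _ = Qball 0 0) ?haar_Qball //=.
    by rewrite expr0z expr1n.
  have uV : V \in unitmx.
    by rewrite unitmxE unitfE -(abs_eq0 QpK) dV oner_eq0.
  have int_ball (W : 'M[K]_n) (x : 'cV[K]_n) : (forall i j, absK (W i j) <= 1) ->
      vnorm absK x <= 1 -> vnorm absK (W *m x) <= 1.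
    move=> W1 x1; apply: le_trans (vnorm_mulmx QpK _ _) _.
    by rewrite mulr_ile1 ?mnorm_ge0 ?vnorm_ge0 //; apply/mnorm_leP.
  apply/seteqP; split => x; rewrite /Qball /= /mulmxT expr0z !subr0; last exact: int_ball.
  move=> Vx; rewrite -[x : 'cV[K]_n](mulKmx uV); apply: int_ball => // i j.
  rewrite /invmx uV mxE (absM QpK) (absV QpK) dV invr1 mul1r mxE /cofactor.
  rewrite (absM QpK) (absX QpK) (absN QpK) (abs1 QpK) expr1n mul1r /determinant.
  apply: (abs_sum_le QpK) => // s _; rewrite (absM QpK) (absX QpK) (absN QpK) (abs1 QpK).
  rewrite expr1n mul1r (abs_prod QpK); apply: prodr_ile1 => k _.
  by rewrite absge0 !mxE V1.
- rewrite /d (_ : _ @^-1` _ = Qball 0 1) ?haar_Qball ?expr1z //=.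
  apply/seteqP; split => x; rewrite /Qball /= /mulmxT expr0z expr1z !subr0 mul_scalar_mx;
    by rewrite (vnormZ QpK) (Qp_abs_p QpK) mulrC ler_pdivrMr // mul1r.
Qed.

Lemma haar_integral_mulmx A (f : T -> \bar R) : A \in unitmx ->
  measurable_fun setT f -> (forall x, 0 <= f x)%E ->
  (\int[mu]_x f (mulmxT A x) = (absK (\det A))^-1%:E * \int[mu]_x f x)%E.
Proof.
move=> uA mf f0; have r0 : 0 <= (absK (\det A))^-1 by rewrite invr_ge0.
have <- := ge0_integral_mscale mu measurableT (NngNum r0) mf (fun x _ => f0 x).
transitivity (\int[image_measure mu (measurable_mulmxT A)]_x f x)%E.
  by rewrite (ge0_integral_pushforward (measurable_mulmxT A) mu measurableT mf) // preimage_setT.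
apply: eq_measure_integral => E mE _ /=; exact: haar_preimage.
Qed.

End Haar.

(** * Power weights *)

Section RealPowers.
Variable R : realType.
Implicit Types x y a r : R.

Lemma ge0_powR_le x y r : 0 <= r -> 0 <= x -> x <= y -> x `^ r <= y `^ r.
Proof.
by move=> r0 x0 xy; apply: ge0_ler_powR; rewrite ?nnegrE // (le_trans x0).
Qed.

Lemma gt0_powRD x a r : 0 < x -> x `^ (a + r) = x `^ a * x `^ r.
Proof. by move=> x0; rewrite powRD // (lt0r_neq0 x0) implybT. Qed.

Lemma powRD_le x y r : 0 <= x -> 0 <= y -> 0 <= r ->
  (x + y) `^ r <= 2 `^ r * (x `^ r + y `^ r).
Proof.
wlog xy : x y / x <= y => [h|] x0 y0 r0.
  by have [xy|/ltW xy] := leP x y; [|rewrite addrC [x `^ r + _]addrC]; exact: h.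
apply: le_trans (_ : (2 * y) `^ r <= _).
  by apply: ge0_powR_le => //; [exact: addr_ge0 | rewrite mulr_natl mulr2n lerD2r].
by rewrite powRM // ler_wpM2l ?powR_ge0 // lerDr powR_ge0.
Qed.


Lemma geometric_sum_le x (N : nat) : 0 <= x < 1 -> \sum_(0 <= k < N) x ^+ k <= (1 - x)^-1.
Proof.
move=> /andP[x0 x1]; have d0 : 0 < 1 - x by rewrite subr_gt0.
rewrite -[leRHS]mul1r ler_pdivlMr // mulrC big_mkord -opprB mulNr -subrX1 opprB.
by rewrite lerBlDr lerDl exprn_ge0.
Qed.

End RealPowers.

Section Weights.
Variables (R : realType) (p : nat) (K : fieldType) (absK : K -> R).
Hypotheses (p_pr : prime p) (QpK : is_Qp p absK).
Local Notation P := (p%:R : R).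
Let P0 : 0 < P := P_gt0 R p_pr.
Let Pn0 : P != 0 := P_neq0 R p_pr.
Let Pz0 (k : int) : 0 < P ^ k := Pz_gt0 R p_pr k.
Let Pzge0 (k : int) : 0 <= P ^ k := Pz_ge0 R p_pr k.
Let absge0 x : 0 <= absK x := abs_ge0 QpK x.
Variable n' : nat.
Local Notation n := n'.+1.
Local Notation T := (Qpn p absK n).
Let vge0 (x : T) : 0 <= vnorm absK (x : 'cV[K]_n) := vnorm_ge0 absK x.
Hint Resolve P0 Pn0 Pz0 Pzge0 absge0 vge0 : core.
Variable mu : {measure set T -> \bar R}.
Hypothesis haar : is_Haar mu.
Local Notation B := (Bg p absK n).

Lemma measurable_B g : measurable (B g).
Proof. exact: measurable_Bg. Qed.
Hint Resolve measurable_B : core.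

Lemma haar_B g : mu (B g) = ((P ^ g) ^+ n)%:E.
Proof. by rewrite -Qball0 (haar_Qball p_pr QpK haar). Qed.

Lemma measurable_origin : measurable [set x : T | (x : 'cV[K]_n) = 0].
Proof.
have := measurable_vnorm p_pr QpK (n := n) measurableT (measurable_set1 0).
rewrite setTI; congr measurable; apply/seteqP; split => x /=.
  by move/eqP; rewrite (vnorm_eq0 QpK) => /eqP.
by move=> ->; rewrite (vnorm0 QpK).
Qed.

Lemma haar_origin : mu [set x : T | (x : 'cV[K]_n) = 0] = 0%E.
Proof.
have sub (k : int) : [set x : T | (x : 'cV[K]_n) = 0] `<=` B k.
  by move=> x /= ->; rewrite /Bg /= (vnorm0 QpK).
have m0 := measurable_origin.
apply/eqP; rewrite eq_le measure_ge0 andbT; apply/lee_addgt0Pr => e e0.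
have e1 : 0 < Num.min e 1 by rewrite lt_min e0 ltr01.
have [k] := Pz_archi p_pr e1.
rewrite lt_min add0e => /andP[ke k1].
apply: le_trans (_ : (mu (B k) <= _)%E); first by apply: le_measure; rewrite ?inE.
rewrite haar_B lee_fin; apply: le_trans (ltW ke).
by rewrite exprS ler_piMr // exprn_ile1 // ltW.
Qed.

Lemma pw_ge0 a x : 0 <= @pw R p K absK n a x. Proof. exact: powR_ge0. Qed.
Hint Resolve pw_ge0 : core.

Lemma measurable_pw_EFin a (D : set T) : measurable_fun D (fun x => (@pw R p K absK n a x)%:E).
Proof. by apply/measurable_EFinP; apply: measurable_funTS; exact: measurable_pw. Qed.

Lemma vnorm_scale (k : int) (x : 'cV[K]_n) :
  vnorm absK ((p%:R ^ (- k))%:M *m x) = P ^ k * vnorm absK x.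
Proof. by rewrite mul_scalar_mx (vnormZ QpK) (absP QpK) opprK. Qed.

(** The scalar [p ^ (- g)] has absolute value [P ^ g], so it maps [B 0] onto [B g]. *)
Lemma haar_integral_scale (h : T -> \bar R) g :
  measurable_fun setT h -> (forall x, 0 <= h x)%E ->
  (\int[mu]_(x in B g) h x =
   ((P ^ g) ^+ n)%:E * \int[mu]_(y in B 0) h (mulmxT (p%:R ^ (- g))%:M y))%E.
Proof.
move=> mh h0; pose A : 'M[K]_n := (p%:R ^ (- g))%:M.
have pK : (p%:R : K) ^ (- g) != 0 by rewrite expfz_neq0 // (pK_neq0 p_pr QpK).
have uA : A \in unitmx by rewrite unitmxE det_scalar unitfE expf_neq0.
have mB : measurable_fun setT (h \_ (B g)).
  by apply/(measurable_restrictT _ (measurable_B g)); exact: measurable_funTS.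
have := haar_integral_mulmx p_pr QpK haar uA mB (erestrict_ge0 (fun x _ => h0 x)).
rewrite det_scalar (absX QpK) (absP QpK) opprK => e.
rewrite [in RHS]integral_mkcond.
rewrite (eq_integral (fun x => (h \_ (B g)) (mulmxT A x))) => [|x _].
  by rewrite e -integral_mkcond muleA -EFinM divff ?mul1e // expf_neq0 // lt0r_neq0.
have eB : (mulmxT A x \in B g) = (x \in B 0).
  apply/idP/idP; rewrite !inE /Bg /= /mulmxT vnorm_scale expr0z.
    by rewrite -{2}[P ^ g]mulr1 ler_pM2l.
  by rewrite -{2}[P ^ g]mulr1 ler_pM2l.
by rewrite !patchE eB.
Qed.

Lemma wmeas_scale a g :
  wmeas mu (pw a) (B g) = (((P ^ g) `^ (n%:R + a))%:E * wmeas mu (pw a) (B 0))%E.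
Proof.
rewrite /wmeas (haar_integral_scale g (@measurable_pw_EFin a setT)); last by move=> x; rewrite lee_fin.
rewrite (eq_integral (fun x => ((P ^ g) `^ a)%:E * (pw a x)%:E)%E) => [|x _]; last first.
  by rewrite -EFinM /pw /mulmxT vnorm_scale powRM.
rewrite ge0_integralZl_EFin //; last 3 first.
- by move=> x _; rewrite lee_fin.
- exact: measurable_pw_EFin.
- exact: powR_ge0.
by rewrite muleA -EFinM gt0_powRD // powR_mulrn.
Qed.

Lemma wmeas_ge0 a g : (0 <= wmeas mu (pw a) (B g))%E.
Proof. by apply: integral_ge0 => x _; rewrite lee_fin. Qed.

(* Sum over the spheres of radius [P ^ - k] inside the unit ball. *)
Lemma wmeas_lty a : - n%:R < a -> (wmeas mu (pw a) (B 0) < +oo)%E.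
Proof.
move=> na; pose rho := P `^ (- (n%:R + a)).
have rho1 : 0 <= rho < 1.
  rewrite powR_ge0 /= /rho powRN invf_lt1 ?powR_gt0 //.
  have na0 : 0 < n%:R + a by rewrite -(ltrBlDl) sub0r.
  have := gt0_ltr_powR na0 (_ : 1 \in Num.nneg) (_ : P \in Num.nneg) (P_gt1 R p_pr).
  by rewrite powR1; apply; rewrite ?nnegrE.
(* Each sphere is enlarged to the ball that it bounds. The [k]-th term then has integral
   [rho ^+ k]. *)
pose u (k : nat) (x : T) : \bar R :=
  (((P ^ (- k%:Z)) `^ a)%:E * (\1_(B (- k%:Z)) x)%:E)%E.
have u0 k x : (0 <= u k x)%E.
  by rewrite mule_ge0 // lee_fin ?powR_ge0.
have mu_ k : measurable_fun setT (u k).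
  apply/measurable_EFinP; apply: measurable_funM; first exact: measurable_cst.
  exact: measurable_indic.
have le_u (x : T) : B 0 x -> ((pw a x)%:E <= \sum_(0 <= k <oo) u k x)%E.
  move=> Bx; have [k [kx vx]] : exists k : nat,
      B (- k%:Z) x /\ pw a x <= (P ^ (- k%:Z)) `^ a.
    (* At the origin the weight is 0, or 1 if [a = 0]. The term [k = 0] covers both cases. *)
    have [x0|x0] := eqVneq (x : 'cV[K]_n) 0.
      exists 0%N; split; first by rewrite oppr0.
      rewrite /pw x0 (vnorm0 QpK) oppr0 expr0z powR1.
      by have [->|a0] := eqVneq a 0; rewrite ?powRr0 ?powR0.
    have [k xk] := vnorm_val p_pr QpK x0.
    have k0 : k <= 0 by rewrite -(le_Pz R p_pr) expr0z -xk -(expr0z P).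
    exists `|k|%N; rewrite (_ : - `|k|%N%:Z = k); last lia.
    by rewrite /B /Bg /pw /= xk.
  apply: le_trans (nneseries_lim_ge k.+1 (fun k _ _ => u0 k x)).
  rewrite big_nat_recr //= -[leLHS]add0e leeD ?sume_ge0 //.
  by rewrite /u indicE mem_set // mule1 lee_fin.
apply: le_lt_trans (_ : (\int[mu]_(x in B 0) \sum_(0 <= k <oo) u k x)%E < +oo)%E.
  apply: ge0_le_integral => //.
  - by move=> x _; rewrite lee_fin.
  - exact: measurable_pw_EFin.
  - apply: ge0_emeasurable_sum => [k x _ _|k _]; [exact: u0 | exact: measurable_funTS].
rewrite integral_nneseries //; last by move=> k; exact: measurable_funTS.
apply: le_lt_trans (_ : ((1 - rho)^-1%:E < +oo)%E); last exact: ltry.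
apply: lime_le; first by apply: is_cvg_nneseries => k _ _; exact: integral_ge0.
apply: nearW => N; apply: le_trans (_ : ((\sum_(0 <= k < N) rho ^+ k)%:E <= _)%E); last first.
  by rewrite lee_fin geometric_sum_le.
rewrite -sumEFin; apply: lee_sum => k _.
rewrite /u ge0_integralZl_EFin ?powR_ge0 //; last first.
  exact/measurable_EFinP/measurable_indic.
rewrite integral_indic // setIidl; last first.
  by move=> x; rewrite /Bg /= => /le_trans; apply; rewrite (le_Pz R p_pr); lia.
rewrite haar_B -EFinM lee_fin -(powR_mulrn n (Pzge0 (- k%:Z))) -gt0_powRD // addrC.
have -> : P ^ (- k%:Z) = P `^ (- k%:R) by rewrite powRN powR_mulrn // exprnN.
by rewrite -powRrM -[rho ^+ k]powR_mulrn ?powR_ge0 // -powRrM mulrC mulNr mulrN.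
Qed.

(** The weight is 1 on the unit sphere, whose measure is [1 - P ^ (- n)]. *)
Lemma wmeas_gt0 a : (0 < wmeas mu (pw a) (B 0))%E.
Proof.
have m1 : measurable (B 0 `\` B (-1)) by exact: measurableD.
have sub1 : B (-1) `<=` B 0.
  by move=> x; rewrite /Bg /= => /le_trans; apply; rewrite (le_Pz R p_pr).
apply: lt_le_trans (_ : (\int[mu]_(x in B 0 `\` B (-1)) (pw a x)%:E <= _)%E); last first.
  apply: ge0_subset_integral => //; first exact: measurable_pw_EFin.
  by move=> x _; rewrite lee_fin.
rewrite (eq_integral (cst 1%E)) => [|x]; last first.
  rewrite inE /Bg /= => -[x1 x0]; congr (_%:E); rewrite /pw.
  have nx : (x : 'cV[K]_n) != 0.
    by apply/eqP => e; apply: x0; rewrite e (vnorm0 QpK).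
  have [k xk] := vnorm_val p_pr QpK nx; move: x0 x1; rewrite xk !(le_Pz R p_pr) => x0 x1.
  by rewrite (_ : k = 0) ?expr0z ?powR1 //; lia.
have fB : (mu (B 0) < +oo)%E by rewrite haar_B ltry.
rewrite integral_cst // mul1e measureD // setIidr //.
rewrite [X in (X - _)%E]haar_B [X in (_ - X)%E]haar_B -EFinB lte_fin expr0z expr1n subr_gt0.
by rewrite exprn_ilt1 //= exprN1 invf_lt1 ?P_gt1.
Qed.

Definition ball_weight a : R := fine (wmeas mu (pw a) (B 0)).

Lemma wmeasE a g : - n%:R < a ->
  wmeas mu (pw a) (B g) = ((P ^ g) `^ (n%:R + a) * ball_weight a)%:E.
Proof.
move=> na; rewrite wmeas_scale EFinM /ball_weight fineK //.
by rewrite ge0_fin_numE ?wmeas_ge0 // wmeas_lty.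
Qed.

Lemma ball_weight_gt0 a : - n%:R < a -> 0 < ball_weight a.
Proof. by move=> na; rewrite fine_gt0 // wmeas_gt0 wmeas_lty. Qed.

(** * Weighted integrals and their behaviour under linear maps *)

Section WeightedIntegral.
Variables (a r : R).
Implicit Types (f h : T -> R) (E : set T) (A : 'M[K]_n).
Hypothesis r0 : 0 <= r.
Local Notation w := (@pw R p K absK n a).

Lemma measurable_wint_integrand f E : measurable_fun setT f ->
  measurable_fun E (fun x => (`|f x| `^ r * w x)%:E).
Proof.
move=> mf; apply/measurable_EFinP; apply: measurable_funTS.
apply: measurable_funM; last exact: measurable_pw.
by apply: (measurableT_comp (measurable_powR r)); exact: measurableT_comp.
Qed.
Hint Resolve measurable_wint_integrand : core.

Lemma wint_integrand_ge0 f x : (0 <= (`|f x| `^ r * w x)%:E)%E.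
Proof. by rewrite lee_fin mulr_ge0 // powR_ge0. Qed.
Hint Resolve wint_integrand_ge0 : core.

Lemma wint_ge0 f E : (0 <= wint mu E w r f)%E.
Proof. by apply: integral_ge0 => x _; exact: wint_integrand_ge0. Qed.

Lemma wintD f h E : measurable E -> measurable_fun setT f -> measurable_fun setT h ->
  (wint mu E w r (fun x => f x + h x)%R <=
   (2 `^ r)%:E * (wint mu E w r f + wint mu E w r h))%E.
Proof.
move=> mE mf mh; have mF := measurable_wint_integrand (E := E) mf.
have mH := measurable_wint_integrand (E := E) mh.
rewrite /wint -ge0_integralD //.
rewrite -ge0_integralZl_EFin ?powR_ge0 //; last 2 first.
- by move=> x _; rewrite adde_ge0.
- exact: emeasurable_funD.
apply: ge0_le_integral => //.
- by move=> x _; exact: (wint_integrand_ge0 (fun x => f x + h x)).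
- exact: (measurable_wint_integrand (measurable_funD mf mh)).
- by apply: measurable_funeM; exact: emeasurable_funD.
move=> x _; rewrite -EFinD -EFinM lee_fin -mulrDl mulrA ler_wpM2r //.
apply: le_trans (powRD_le _ _ r0); rewrite ?normr_ge0 //.
by apply: ge0_powR_le => //; exact: ler_normD.
Qed.

Lemma wint_cst c E : measurable E ->
  wint mu E w r (fun=> c) = ((`|c| `^ r)%:E * wmeas mu w E)%E.
Proof.
move=> mE; rewrite /wint /wmeas -ge0_integralZl_EFin ?powR_ge0 //.
- by move=> x _; rewrite lee_fin.
- exact: measurable_pw_EFin.
Qed.

(** Its [q_i]-th root is [mu_i], and its [r_i]-th root enters [psi_i]. *)
Definition weight_factor (A : 'M[K]_n) : R :=
  Num.max (mnorm absK (invmx A) `^ a) (mnorm absK A `^ (- a)) * absK (\det (invmx A)).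

Lemma weight_factor_ge0 A : 0 <= weight_factor A.
Proof. by rewrite mulr_ge0 // le_max powR_ge0. Qed.

Lemma unitmx_mnorm_gt0 A : A \in unitmx -> 0 < mnorm absK A.
Proof.
move=> uA; apply: (mnorm_gt0 QpK); apply: contraTneq uA => ->.
by rewrite unitmxE det0 unitr0.
Qed.

Lemma weight_factor_gt0 A : A \in unitmx -> 0 < weight_factor A.
Proof.
move=> uA; rewrite mulr_gt0 ?lt_max ?powR_gt0 ?unitmx_mnorm_gt0 ?unitmx_inv //.
by rewrite (abs_gt0 QpK) -unitfE -unitmxE unitmx_inv.
Qed.

(** The maximum covers both signs of [a]: [|x| <= ||A^-1|| |A x|] serves for [a >= 0], and
    [|A x| <= ||A|| |x|] for [a < 0]. *)
Lemma pw_mulmx_le A x : A \in unitmx ->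
  w x <= Num.max (mnorm absK (invmx A) `^ a) (mnorm absK A `^ (- a)) * w (mulmxT A x).
Proof.
move=> uA; have A0 := unitmx_mnorm_gt0 uA; have [a0|a0] := leP 0 a.
  apply: le_trans (_ : mnorm absK (invmx A) `^ a * w (mulmxT A x) <= _); last first.
    by rewrite ler_wpM2r // le_max lexx.
  rewrite /pw -powRM ?mnorm_ge0 //; apply: ge0_powR_le => //.
  by have := vnorm_mulmx QpK (invmx A) (A *m (x : 'cV[K]_n)); rewrite mulKmx.
(* A negative power of 0 is 0 by convention, so the monotonicity argument excludes the origin. *)
have [x0|x0] := eqVneq (x : 'cV[K]_n) 0.
  rewrite {1}/pw x0 (vnorm0 QpK) powR0 ?lt_eqF //.
  by rewrite mulr_ge0 // le_max powR_ge0.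
apply: le_trans (_ : mnorm absK A `^ (- a) * w (mulmxT A x) <= _); last first.
  by rewrite ler_wpM2r // le_max lexx orbT.
have y0 : 0 < vnorm absK (A *m (x : 'cV[K]_n)).
  rewrite (vnorm_gt0 QpK); apply: contra_neq x0 => Ax.
  by rewrite -[x : 'cV[K]_n](mulKmx uA) Ax mulmx0.
have x1 : 0 < vnorm absK (x : 'cV[K]_n) by rewrite (vnorm_gt0 QpK).
rewrite powRN mulrC ler_pdivlMr ?powR_gt0 // /pw -powRM ?(ltW A0) // -(opprK a) !(powRN _ (- a)).
rewrite lef_pV2 ?posrE ?powR_gt0 ?mulr_gt0 //; apply: ge0_powR_le => //.
- by rewrite oppr_ge0 ltW.
- by rewrite mulrC; have := vnorm_mulmx QpK A (x : 'cV[K]_n).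
Qed.

Lemma wint_mulmx f A E E' : A \in unitmx -> measurable E -> measurable E' ->
  measurable_fun setT f -> (forall x, E x -> E' (mulmxT A x)) ->
  (wint mu E w r (f \o mulmxT A) <= (weight_factor A)%:E * wint mu E' w r f)%E.
Proof.
move=> uA mE mE' mf EE'; rewrite /weight_factor; set M := Num.max _ _.
have M0 : 0 <= M by rewrite le_max powR_ge0.
pose F : T -> \bar R := (fun x => (M * (`|f x| `^ r * w x))%:E) \_ E'.
have F0 x : (0 <= F x)%E.
  by apply: erestrict_ge0 => {}x _; rewrite lee_fin !mulr_ge0 ?powR_ge0.
have mF : measurable_fun setT F.
  apply/(measurable_restrictT _ mE'); under eq_fun do rewrite EFinM.
  by apply: measurable_funeM; exact: measurable_wint_integrand.
apply: le_trans (_ : (\int[mu]_x F (mulmxT A x) <= _)%E).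
  rewrite /wint integral_mkcond; apply: ge0_le_integral => //.
  - by move=> x _; apply: erestrict_ge0 => {}x _; exact: wint_integrand_ge0.
  - apply/(measurable_restrictT _ mE); apply: measurable_wint_integrand.
    by apply: measurableT_comp => //; exact: measurable_mulmxT.
  - by apply: measurableT_comp => //; exact: measurable_mulmxT.
  move=> x _; rewrite patchE; case: ifPn => [|_]; last exact: F0.
  rewrite inE => /EE' Ax; rewrite /F patchE mem_set // lee_fin /= mulrCA.
  by rewrite ler_wpM2l ?powR_ge0 // pw_mulmx_le.
rewrite (haar_integral_mulmx p_pr QpK haar uA mF F0) /F -integral_mkcond.
under eq_integral do rewrite EFinM.
rewrite ge0_integralZl_EFin //; last exact: measurable_wint_integrand.
by rewrite muleA -EFinM det_inv (absV QpK) mulrC.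
Qed.

End WeightedIntegral.
End Weights.

(** * Functions of central mean oscillation *)

(** The first summand dominates if [u ^ (r - 1) * V >= 1], the second otherwise. This plays the part
    of Young's inequality. *)
Lemma le_powR_add (R : realType) (u V r : R) : 1 < r -> 0 <= u -> 0 < V ->
  u <= u `^ r * V + V `^ (- (r - 1)^-1).
Proof.
move=> r1 u0 V0; have rr : 0 < r - 1 by rewrite subr_gt0.
have [h|h] := leP 1 (u `^ (r - 1) * V).
  apply: le_trans (_ : u `^ r * V <= _); last by rewrite lerDl powR_ge0.
  rewrite -[r in u `^ r](subrKC 1) powRD; last by rewrite (addrC 1) subrK gt_eqF // (lt_trans ltr01).
  by rewrite powRr1 // -mulrA ler_peMr.
apply: le_trans (_ : V `^ (- (r - 1)^-1) <= _); last by rewrite lerDr mulr_ge0 ?powR_ge0 // ltW.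
have -> : u = (u `^ (r - 1)) `^ (r - 1)^-1.
  by rewrite -powRrM divff ?lt0r_neq0 // powRr1.
have -> : V `^ (- (r - 1)^-1) = V^-1 `^ ((r - 1)^-1).
  by rewrite -[- (r - 1)^-1]mulN1r powRrM powR_inv1 // ltW.
apply: ge0_powR_le; rewrite ?powR_ge0 ?invr_ge0 ?(ltW rr) //.
by rewrite ltW // -div1r ltr_pdivlMr.
Qed.

Section CMO.
Variables (R : realType) (p : nat) (K : fieldType) (absK : K -> R).
Hypotheses (p_pr : prime p) (QpK : is_Qp p absK).
Local Notation P := (p%:R : R).
Let P0 : 0 < P := P_gt0 R p_pr.
Let Pn0 : P != 0 := P_neq0 R p_pr.
Let Pz0 (k : int) : 0 < P ^ k := Pz_gt0 R p_pr k.
Let Pzge0 (k : int) : 0 <= P ^ k := Pz_ge0 R p_pr k.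
Variable n' : nat.
Local Notation n := n'.+1.
Local Notation T := (Qpn p absK n).
Hint Resolve P0 Pn0 Pz0 Pzge0 : core.
Variable mu : {measure set T -> \bar R}.
Hypothesis haar : is_Haar mu.
Local Notation B := (Bg p absK n).
Let mB g : measurable (B g) := measurable_B g.
Hint Resolve mB : core.
Variables (a r : R).
Hypotheses (r1 : 1 < r) (a_gt : - n%:R < a) (a_lt : a < n%:R * (r - 1)).
Let r0 : 0 < r. Proof. exact: lt_trans r1. Qed.
Let rge0 : 0 <= r. Proof. exact: ltW. Qed.
Let rr : 0 < r - 1. Proof. by rewrite subr_gt0. Qed.
Local Notation w := (@pw R p K absK n a).
Local Notation s := (a * (- (r - 1)^-1)).

(** [s] is the exponent of the dual weight [w ^ (- 1 / (r - 1))]. Its local integrability is the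
    upper bound on [a]. *)
Let s_gt : - n%:R < s.
Proof. by rewrite mulrN ltrN2 ltr_pdivrMr. Qed.

Lemma ae_neq0 : {ae mu, forall x : T, (x : 'cV[K]_n) != 0}.
Proof.
exists [set x : T | (x : 'cV[K]_n) = 0]; split.
- exact: measurable_origin.
- exact: haar_origin.
- by move=> x /= /negP; rewrite negbK => /eqP.
Qed.

(** Integrates [le_powR_add] with [V = t * w x], away from the origin, a null set. The parameter [t]
    is left free to balance the two terms on each ball. *)
Lemma integral_abs_le (f : T -> R) g (t : R) : measurable_fun setT f -> 0 < t ->
  (\int[mu]_(x in B g) (`|f x|)%:E <=
   t%:E * wint mu (B g) w r f + (t `^ (- (r - 1)^-1))%:E * wmeas mu (pw s) (B g))%E.
Proof.
move=> mf t0; have mF := measurable_wint_integrand p_pr QpK a r (E := B g) mf.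
have mW := measurable_pw_EFin p_pr QpK s (D := B g).
have F0 x : (0 <= (`|f x| `^ r * w x)%:E)%E by exact: wint_integrand_ge0.
have W0 x : (0 <= (@pw R p K absK n s x)%:E)%E by rewrite lee_fin powR_ge0.
rewrite /wint /wmeas -ge0_integralZl_EFin ?(ltW t0) // -ge0_integralZl_EFin ?powR_ge0 //.
rewrite -ge0_integralD //; last 4 first.
- by move=> x _; rewrite mule_ge0 // lee_fin ltW.
- exact: measurable_funeM.
- by move=> x _; rewrite mule_ge0 // lee_fin powR_ge0.
- exact: measurable_funeM.
apply: ae_ge0_le_integral => //.
- by apply/measurable_EFinP; apply: measurable_funTS; exact: measurableT_comp.
- by move=> x _; rewrite adde_ge0 // mule_ge0 // lee_fin ?powR_ge0 // ltW.
- by apply: emeasurable_funD; exact: measurable_funeM.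
apply: filterS ae_neq0 => x x0 _; rewrite -!EFinM -EFinD lee_fin.
have wx : 0 < w x by rewrite powR_gt0 // (vnorm_gt0 QpK).
apply: le_trans (le_powR_add r1 (normr_ge0 _) (mulr_gt0 t0 wx)) _.
by rewrite powRM ?(ltW t0) ?(ltW wx) // /pw -powRrM mulrCA.
Qed.

(** * Means and oscillation of a fixed function [b] *)

Variable b : T -> R.
Hypothesis hb : in_CMO mu w r b.

Let mb : measurable_fun setT b. Proof. by case: hb. Qed.

Let mbc c : measurable_fun setT (fun x => b x - c).
Proof. exact: measurable_funB. Qed.

(** The oscillation is defined through [fine], which sends [+oo] to 0. Finiteness makes its bound
    meaningful. *)
Lemma cmo_wint_lty g c : (wint mu (B g) w r (fun x => (b x - c)%R) < +oo)%E.
Proof.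
have [_ [/(_ g) bfin _]] := hb.
apply: le_lt_trans (wintD p_pr QpK mu a rge0 (mB g) mb (measurable_cst (- c))) _.
rewrite (wint_cst p_pr QpK mu a r _ (mB g)) (wmeasE p_pr QpK haar _ a_gt) -EFinM.
by rewrite lte_mul_pinfty ?lee_fin ?powR_ge0 // lte_add_pinfty // ltry.
Qed.

Lemma cmo_bound : exists2 M : R, 0 <= M & forall g,
  (wint mu (B g) w r (fun x => (b x - bmean mu b g)%R) <= (M * ((P ^ g) `^ (n%:R + a)))%:E)%E.
Proof.
have [_ [_ [M hM]]] := hb; exists (M `^ r * ball_weight mu a) => [|g].
  by rewrite mulr_ge0 ?powR_ge0 // ltW // ball_weight_gt0.
have Dfin := cmo_wint_lty g (bmean mu b g).
have D0 : (0 <= wint mu (B g) w r (fun x => (b x - bmean mu b g)%R))%E by exact: wint_ge0.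
have Wg0 : 0 < (P ^ g) `^ (n%:R + a) * ball_weight mu a by rewrite mulr_gt0 ?powR_gt0 ?ball_weight_gt0.
rewrite -[leLHS]fineK ?ge0_fin_numE // lee_fin -mulrA [ball_weight _ _ * _]mulrC -ler_pdivrMr //.
have := hM g; rewrite (wmeasE p_pr QpK haar _ a_gt) /= => h.
have /(ge0_powR_le rge0 (powR_ge0 _ _)) := h.
by rewrite -powRrM mulVf ?lt0r_neq0 // powRr1 // divr_ge0 ?fine_ge0 // ltW.
Qed.

Lemma cmo_integrable g : mu.-integrable (B g) (EFin \o b).
Proof.
apply/integrableP; split; first by apply/measurable_EFinP; exact: measurable_funTS.
have := integral_abs_le g mb ltr01; move=> /le_lt_trans; apply.
rewrite (wmeasE p_pr QpK haar _ s_gt) -EFinM mul1e lte_add_pinfty ?ltry //.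
by case: hb => _ [].
Qed.

Lemma bmean_dist g c :
  ((`|bmean mu b g - c| * (P ^ g) ^+ n)%:E <= \int[mu]_(x in B g) (`|b x - c|)%:E)%E.
Proof.
have ib := cmo_integrable g; have V0 : 0 < (P ^ g) ^+ n by rewrite exprn_gt0.
have mBg := haar_B p_pr QpK haar g.
have ic : mu.-integrable (B g) (EFin \o cst c).
  apply/integrableP; split; first by apply/measurable_EFinP; exact: measurable_cst.
  by rewrite /= (integral_cst mu (mB g)) mBg -EFinM ltry.
have e : (\int[mu]_(x in B g) ((b x)%:E - c%:E) = ((bmean mu b g - c) * (P ^ g) ^+ n)%:E)%E.
  transitivity (\int[mu]_(x in B g) (b x)%:E - \int[mu]_(x in B g) c%:E)%E.
    exact: (integralB_EFin (mB g) ib ic).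
  have -> : (\int[mu]_(x in B g) c%:E = c%:E * mu (B g))%E.
    exact: (integral_cst mu (mB g) c%:E).
  rewrite mBg.
  rewrite -[X in (X - _)%E]fineK; last exact: integrable_fin_num.
  by rewrite -EFinM -EFinB mulrBl /bmean mBg /= divfK ?gt_eqF.
rewrite -[X in _ * X]gtr0_norm // -normrM -[leLHS]/(`| ((bmean mu b g - c) * _)%:E |)%E -e.
apply: le_trans (le_abse_integral mu (mB g) _) _.
  by apply/measurable_EFinP; apply: measurable_funTS; exact: mbc.
by under eq_integral do rewrite -EFinB.
Qed.

Lemma bmean_shift : exists2 C : R, 0 <= C & forall g k : int,
  `|bmean mu b g - bmean mu b (g + k)| <= C * `|k%:~R|.
Proof.
have [M M0 hM] := cmo_bound.
pose C0 := M + ball_weight mu s; have C0_ge0 : 0 <= C0 by rewrite addr_ge0 // ltW // ball_weight_gt0.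
have mean_osc g :
    (\int[mu]_(x in B g) (`|b x - bmean mu b g|)%:E <= (C0 * (P ^ g) ^+ n)%:E)%E.
  (* With this [t] both terms scale like [(P ^ g) ^+ n], the volume of the ball, so [C0] does not
     depend on [g]. *)
  have t0 : 0 < (P ^ g) `^ (- a) by rewrite powR_gt0.
  apply: le_trans (integral_abs_le g (mbc _) t0) _.
  rewrite (wmeasE p_pr QpK haar _ s_gt).
  apply: (@le_trans _ _ (((P ^ g) `^ (- a))%:E * (M * (P ^ g) `^ (n%:R + a))%:E +
      (((P ^ g) `^ (- a)) `^ (- (r - 1)^-1))%:E * ((P ^ g) `^ (n%:R + s) * ball_weight mu s)%:E)%E).
    by rewrite leeD2r // lee_wpmul2l ?lee_fin ?powR_ge0.
  rewrite -!EFinM -EFinD lee_fin -powRrM -(powR_mulrn n (Pzge0 g)) mulrCA -gt0_powRD //.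
  rewrite mulrA -gt0_powRD // (_ : - a + (n%:R + a) = n%:R); last by ring.
  rewrite (_ : - a * - (r - 1)^-1 + (n%:R + s) = n%:R); last by ring.
  by rewrite [X in _ + X]mulrC -mulrDl.
(* The factor [P ^+ n] is the volume ratio lost by enlarging the domain from [B g] to
   [B (g + 1)]. *)
have step g : `|bmean mu b g - bmean mu b (g + 1)| <= C0 * P ^+ n.
  have V0 : 0 < (P ^ g) ^+ n by rewrite exprn_gt0.
  rewrite -(ler_pM2r V0) -mulrA -exprMn -lee_fin.
  apply: le_trans (bmean_dist _ _) _.
  rewrite (_ : P * P ^ g = P ^ (g + 1)); last by rewrite (PzD R p_pr) expr1z mulrC.
  apply: le_trans (mean_osc _); apply: ge0_subset_integral => //.
    by apply/measurable_EFinP; apply: measurable_funTS; apply: measurableT_comp => //; exact: mbc.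
  by move=> x; rewrite /Bg /= => /le_trans; apply; rewrite (le_Pz R p_pr) lerDl.
have up (k : nat) g : `|bmean mu b g - bmean mu b (g + k%:Z)| <= C0 * P ^+ n * k%:R.
  elim: k => [|k ih]; first by rewrite addr0 subrr normr0 mulr0.
  rewrite -(addn1 k) PoszD addrA natrD mulrDr mulr1 -(subrKA (bmean mu b (g + k%:Z))).
  by apply: le_trans (ler_normD _ _) _; apply: lerD.
exists (C0 * P ^+ n) => [|g [k|k]]; first by rewrite mulr_ge0.
  by rewrite -pmulrn normr_nat; exact: up.
rewrite NegzE distrC mulrNz normrN -pmulrn normr_nat.
by have := up k.+1 (g - k.+1%:Z); rewrite subrK.
Qed.

(** One bound for each piece of [b(x) - b(A x)]: the 1 for the oscillation of [b] on [B_g], the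
    middle one for the oscillation seen through [A], the logarithm for the distance between the two
    means. *)
Lemma psi_fn_ge (A : 'M[K]_n) (k : int) : A \in unitmx -> mnorm absK A = P ^ k ->
  [/\ 1 <= psi_fn p absK a r A,
      (weight_factor absK a A) `^ r^-1 * (P ^ k) `^ ((n%:R + a) / r) <= psi_fn p absK a r A
    & `|k%:~R| <= psi_fn p absK a r A].
Proof.
move=> uA Ak; have lP : ln P != 0 by rewrite gt_eqF // ln_gt0 // P_gt1.
have logk : logp p (mnorm absK A) = k%:~R.
  by rewrite /logp Ak -powR_intmul // ln_powR mulfK.
have x0 : 0 <= 2 * mnorm absK A ^+ n / absK (\det A).
  by rewrite divr_ge0 ?mulr_ge0 ?exprn_ge0 ?mnorm_ge0 ?(abs_ge0 QpK).
have y0 : 0 <= (weight_factor absK a A) `^ r^-1 * (P ^ k) `^ ((n%:R + a) / r).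
  by rewrite mulr_ge0 ?powR_ge0.
rewrite /psi_fn logk -/(weight_factor absK a A) Ak; rewrite Ak in x0.
by have := normr_ge0 (k%:~R : R); split; lra.
Qed.

(** [D] precedes [A], so that [psi] carries the whole dependence on [y]. The difference is split as
    [(b(x) - c1) + (c1 - c2) + (c2 - b(A x))], with [c2] the mean over [B_(g+k)], a ball containing
    [A B_g]. *)
Lemma cmo_commutator g : exists2 D : R, 0 <= D & forall A : 'M[K]_n, A \in unitmx ->
  (wint mu (B g) w r (fun x => (b x - b (mulmxT A x))%R) <=
     (D * psi_fn p absK a r A `^ r)%:E)%E.
Proof.
have [M M0 hM] := cmo_bound; have [C C0 hC] := bmean_shift.
set U := (P ^ g) `^ (n%:R + a); have U0 : 0 <= U by exact: powR_ge0.
set W := ball_weight mu a; have W0 : 0 <= W by rewrite ltW // ball_weight_gt0.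
set t := 2 `^ r; have t0 : 0 <= t by exact: powR_ge0.
(* The nesting comes from splitting the three-term sum by two uses of [wintD], each costing
   [2 ^ r]. *)
have D0 : 0 <= t * (M * U + t * (C `^ r * (U * W) + M * U)).
  by rewrite !(mulr_ge0, addr_ge0, powR_ge0).
exists (t * (M * U + t * (C `^ r * (U * W) + M * U))) => // A uA.
have A0 : A != 0 by apply: contraTneq uA => ->; rewrite unitmxE det0 unitr0.
have [k Ak] := mnorm_val p_pr QpK A0.
have [psi1 psi2 psi3] := psi_fn_ge uA Ak; set psi := psi_fn _ _ _ _ _ in psi1 psi2 psi3 *.
have psi0 : 0 <= psi by exact: le_trans psi1.
pose c1 := bmean mu b g; pose c2 := bmean mu b (g + k).
pose f2 : T -> R := fun x => c2 - b x.
have mA : measurable_fun setT (mulmxT A : T -> T) by exact: measurable_mulmxT.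
have mf2 : measurable_fun setT f2 by exact: measurable_funB.
have mf2A : measurable_fun setT (f2 \o mulmxT A) by exact: measurableT_comp.
have bound1 : (wint mu (B g) w r (fun x => (b x - c1)%R) <= (M * U)%:E)%E by exact: hM.
have bound2 : (wint mu (B g) w r (fun=> (c1 - c2)%R) <= (C `^ r * (U * W) * psi `^ r)%:E)%E.
  rewrite (wint_cst p_pr QpK mu a r _ (mB g)) (wmeasE p_pr QpK haar _ a_gt) -EFinM lee_fin.
  rewrite -/U -/W mulrAC; apply: ler_wpM2r; first exact: mulr_ge0.
  rewrite -powRM //; apply: ge0_powR_le => //; apply: le_trans (hC _ _) _.
  by rewrite ler_wpM2l.
have bound3 : (wint mu (B g) w r (f2 \o mulmxT A) <= (M * U * psi `^ r)%:E)%E.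
  have AB x : B g x -> B (g + k) (mulmxT A x).
    rewrite /Bg /= => xg; apply: le_trans (vnorm_mulmx QpK _ _) _.
    by rewrite Ak (PzD R p_pr) mulrC ler_wpM2r.
  apply: le_trans (wint_mulmx p_pr QpK haar a r uA (mB g) (mB (g + k)) mf2 AB) _.
  have -> : wint mu (B (g + k)) w r f2 = wint mu (B (g + k)) w r (fun x => (b x - c2)%R).
    by apply: eq_integral => x _; rewrite /f2 distrC.
  apply: le_trans (lee_wpmul2l _ (hM (g + k))) _; first by rewrite lee_fin (weight_factor_ge0 QpK).
  (* Once the factor [U] of [B_g] is removed, what is left is the [r]-th power of the second bound
     of [psi_fn_ge]. *)
  rewrite -EFinM lee_fin mulrCA -mulrA ler_wpM2l // (PzD R p_pr) powRM // -/U mulrCA.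
  rewrite ler_wpM2l //; have := ge0_powR_le rge0 _ psi2.
  rewrite powRM ?powR_ge0 // -!powRrM mulVf ?lt0r_neq0 // divfK ?lt0r_neq0 //.
  by rewrite powRr1 ?(weight_factor_ge0 QpK) //; apply; rewrite mulr_ge0 ?powR_ge0.
rewrite (_ : (fun x => _) = (fun x => (b x - c1) + (fun x => (c1 - c2) + (f2 \o mulmxT A) x) x)).
  2: by apply/funext => x /=; rewrite /f2; ring.
have mg : measurable_fun setT (fun x => (c1 - c2) + (f2 \o mulmxT A) x).
  exact: measurable_funD.
apply: le_trans (wintD p_pr QpK mu a rge0 (mB g) (mbc c1) mg) _.
apply: le_trans (_ : t%:E * ((M * U)%:E + t%:E * ((C `^ r * (U * W) * psi `^ r)%:E
    + (M * U * psi `^ r)%:E)) <= _)%E.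
  rewrite lee_wpmul2l ?lee_fin //; apply: leeD => //.
  apply: le_trans (wintD p_pr QpK mu a rge0 (mB g) (measurable_cst _) mf2A) _.
  by rewrite lee_wpmul2l ?lee_fin //; exact: leeD.
have pr1 : 1 <= psi `^ r by have := ge0_powR_le rge0 ler01 psi1; rewrite powR1.
rewrite !(=^~EFinD, =^~EFinM) lee_fin -!mulrA ler_wpM2l // [leRHS]mulrDl lerD //.
  by rewrite -mulrA ler_wpM2l // ler_peMr.
by rewrite le_eqVlt; apply/orP; left; apply/eqP; ring.
Qed.

End CMO.

(** * A Schur-type test *)

(* Fubini-Tonelli is stated for measures carrying a sigma-finite structure;
   [sf_copy] equips a given measure with it. *)
Section Tonelli.
Context d (X : measurableType d) (R : realType) (m : {measure set X -> \bar R}).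
Hypothesis m_sf : sigma_finite setT m.
Variable F : X * X -> \bar R.
Hypotheses (mF : measurable_fun setT F) (F0 : forall z, (0 <= F z)%E).

Definition sf_copy : set X -> \bar R := m.

HB.instance Definition _ := isMeasure.Build _ _ _ sf_copy
  (measure0 m) (measure_ge0 m) (@measure_semi_sigma_additive _ _ _ m).
HB.instance Definition _ := Measure_isSigmaFinite.Build _ _ _ sf_copy m_sf.

Let m' : {sigma_finite_measure set X -> \bar R} := sf_copy.

Let intE (D : set X) (g : X -> \bar R) : (\int[m']_(x in D) g x = \int[m]_(x in D) g x)%E.
Proof. exact: eq_measure_integral. Qed.

Lemma tonelli_swap : (\int[m]_x \int[m]_y F (x, y) = \int[m]_y \int[m]_x F (x, y))%E.
Proof.
have := @fubini_tonelli _ _ _ _ _ m' m' F mF F0.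
by rewrite !intE; under eq_integral do rewrite intE; under [in RHS]eq_integral do rewrite intE.
Qed.

Lemma measurable_integral_snd : measurable_fun setT (fun x => \int[m]_y F (x, y))%E.
Proof.
have := @measurable_fun_fubini_tonelli_F _ _ _ _ _ m' F mF F0.
by rewrite /fubini_F; under eq_fun do rewrite intE.
Qed.

Lemma measurable_integral_fst : measurable_fun setT (fun y => \int[m]_x F (x, y))%E.
Proof.
have := @measurable_fun_fubini_tonelli_G _ _ _ _ _ m' F mF F0.
by rewrite /fubini_G; under eq_fun do rewrite intE.
Qed.

End Tonelli.

(** At [s = i / c] the left side of the hypothesis is [2 * t * (J + 1) * s ^ q]. Absorbing the [J]
    term gives [s ^ q <= L], and [i = c * s]. Using [J + 1] keeps [c] positive when [J = 0]. *)
Lemma powR_scaling_bound (R : realType) (q t J L i : R) : 1 <= q -> 0 < t -> 0 <= J -> 0 <= L -> 0 <= i ->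
  (forall s, 0 < s -> s `^ (q - 1) * i <= t * (s `^ q * J + L)) ->
  i `^ q <= (2 * t * (J + 1)) `^ q * L.
Proof.
move=> q1 t0 J0 L0 i0 h; have q0 : 0 < q by exact: lt_le_trans q1.
set c := 2 * t * (J + 1); have c0 : 0 < c by rewrite !mulr_gt0 // ltr_wpDl.
have [->|in0] := eqVneq i 0; first by rewrite powR0 ?gt_eqF // mulr_ge0 ?powR_ge0.
have ip : 0 < i by rewrite lt_def in0.
pose s := i / c; have s0 : 0 < s by rewrite divr_gt0.
have iE : i = c * s by rewrite /s mulrC divfK // gt_eqF.
have sq : s `^ (q - 1) * s = s `^ q.
  by rewrite -{2}[s]powRr1 ?ltW // -gt0_powRD // subrK.
have := h _ s0; rewrite {1}iE mulrCA sq /c => hs.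
have sL : s `^ q <= L.
  have : 0 < t * s `^ q * (J + 1) by rewrite !mulr_gt0 ?powR_gt0 // ltr_wpDl.
  have : t * (2 * s `^ q * (J + 1)) <= t * (s `^ q * J + L).
    by rewrite (le_trans _ hs) // le_eqVlt; apply/orP; left; apply/eqP; ring.
  rewrite ler_pM2l // => hs' _; have := powR_ge0 s q; nra.
by rewrite iE powRM ?(ltW c0) ?(ltW s0) // ler_wpM2l ?powR_ge0.
Qed.

(* Jensen's inequality for the measure [k dy] in a form insensitive to constants:
   the parameter [s] of the first hypothesis is optimized pointwise in [x]. *)
Section SchurTest.
Context d (X : measurableType d) (R : realType) (m : {measure set X -> \bar R}).
Hypothesis m_sf : sigma_finite setT m.
Variables (H S : X * X -> R) (k w : X -> R) (D G : set X) (q t E J : R).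
Hypotheses (q1 : 1 <= q) (t0 : 0 < t) (E0 : 0 <= E).
Hypotheses (mH : measurable_fun setT H) (mS : measurable_fun setT S).
Hypotheses (mk : measurable_fun setT k) (mw : measurable_fun setT w) (mD : measurable D).
Hypotheses (k0 : forall y, 0 <= k y) (S0 : forall z, 0 <= S z).
Hypothesis w0 : forall x, 0 <= w x.
Hypotheses (aeG : {ae m, forall x, G x}) (w_gt0 : forall x, G x -> 0 < w x).
Hypothesis kJ : (\int[m]_y (k y)%:E = J%:E)%E.
Hypothesis le_H : {ae m, forall y, forall x s, G x -> 0 < s ->
  s `^ (q - 1) * `|H (x, y)| <= t * (k y * (s `^ q + S (x, y) / w x))}.
Hypothesis le_S : {ae m, forall y, (\int[m]_(x in D) (S (x, y))%:E <= E%:E)%E}.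

Let J0 : 0 <= J.
Proof. by rewrite -lee_fin -kJ; apply: integral_ge0 => y _; rewrite lee_fin. Qed.

Let kS (z : X * X) : \bar R := (k z.2 * S z)%:E.

Let mkS : measurable_fun setT kS.
Proof.
apply/measurable_EFinP; apply: measurable_funM => //.
by apply: measurableT_comp => //; exact: measurable_snd.
Qed.

Let kS0 z : (0 <= kS z)%E. Proof. by rewrite lee_fin mulr_ge0. Qed.

(** By Tonelli its integral over [D] is at most [E * J], so it is finite almost everywhere in
    [D]. *)
Let Lam x : \bar R := (\int[m]_y kS (x, y))%E.

Let Lam0 x : (0 <= Lam x)%E. Proof. exact: integral_ge0. Qed.

Let mLam : measurable_fun setT Lam.
Proof. exact: measurable_integral_snd. Qed.

Let int_Lam : (\int[m]_(x in D) Lam x <= (E * J)%:E)%E.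
Proof.
pose F (z : X * X) : \bar R := ((\1_D z.1)%:E * kS z)%E.
have mF : measurable_fun setT F.
  apply: emeasurable_funM => //; apply/measurable_EFinP.
  by apply: (measurableT_comp (measurable_indic mD)); exact: measurable_fst.
have F0 z : (0 <= F z)%E by rewrite mule_ge0 // lee_fin.
have -> : (\int[m]_(x in D) Lam x = \int[m]_x \int[m]_y F (x, y))%E.
  rewrite integral_mkcond; apply: eq_integral => x _; rewrite patchE /F /= indicE.
  case: ifPn => [xD|xD] /=.
    by apply: eq_integral => y _; rewrite mul1e.
  by under eq_integral do rewrite mul0e; rewrite integral0.
rewrite tonelli_swap //.
have -> : ((E * J)%:E = \int[m]_y (E%:E * (k y)%:E))%E.
  rewrite ge0_integralZl_EFin ?kJ //; first by move=> y _; rewrite lee_fin.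
  exact/measurable_EFinP.
apply: ae_ge0_le_integral => //.
- by move=> y _; exact: integral_ge0.
- exact: measurable_integral_fst.
- by move=> y _; rewrite mule_ge0 // lee_fin.
- by apply: measurable_funeM; exact/measurable_EFinP.
apply: filterS le_S => y Sy _.
have -> : (\int[m]_x F (x, y) = (k y)%:E * \int[m]_(x in D) (S (x, y))%:E)%E.
  rewrite -ge0_integralZl_EFin //; last 2 first.
  - by move=> x _; rewrite lee_fin.
  - apply/measurable_EFinP; apply: measurable_funTS.
    by apply: measurableT_comp => //; exact: pair2_measurable.
  rewrite [RHS]integral_mkcond; apply: eq_integral => x _.
  rewrite patchE /F /= indicE; case: ifPn => _ /=; last by rewrite mul0e.
  by rewrite mul1e /kS /= EFinM.
by rewrite muleC lee_wpmul2r // lee_fin.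
Qed.

Let mHx x : measurable_fun setT (fun y => (H (x, y))%:E).
Proof.
by apply/measurable_EFinP; apply: measurableT_comp => //; exact: pair1_measurable.
Qed.

Let I x : \bar R := (\int[m]_y `|(H (x, y))%:E|)%E.

Let le_I x s : G x -> 0 < s ->
  ((s `^ (q - 1))%:E * I x <= t%:E * ((s `^ q * J)%:E + (w x)^-1%:E * Lam x))%E.
Proof.
move=> wx s0.
have mkSx : measurable_fun setT (fun y => kS (x, y)).
  by apply: measurableT_comp => //; exact: pair1_measurable.
have mkE : measurable_fun setT (fun y => (k y)%:E) by exact/measurable_EFinP.
have kE0 y : setT y -> (0 <= (k y)%:E)%E by rewrite lee_fin.
have mHE : measurable_fun setT (fun y => `|(H (x, y))%:E|%E) by exact: measurableT_comp.
have mR : measurable_fun setT (fun y => (s `^ q)%:E * (k y)%:E + (w x)^-1%:E * kS (x, y))%E.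
  by apply: emeasurable_funD; exact: measurable_funeM.
have R0 y : (0 <= (s `^ q)%:E * (k y)%:E + (w x)^-1%:E * kS (x, y))%E.
  by rewrite adde_ge0 // mule_ge0 // lee_fin ?powR_ge0 ?invr_ge0.
have -> : ((s `^ q * J)%:E + (w x)^-1%:E * Lam x =
    \int[m]_y ((s `^ q)%:E * (k y)%:E + (w x)^-1%:E * kS (x, y)))%E.
  rewrite ge0_integralD //; last 4 first.
  - by move=> y _; rewrite mule_ge0 // lee_fin ?powR_ge0.
  - exact: measurable_funeM.
  - by move=> y _; rewrite mule_ge0 // lee_fin ?invr_ge0.
  - exact: measurable_funeM.
  by rewrite !ge0_integralZl_EFin ?powR_ge0 ?invr_ge0 // kJ EFinM.
rewrite -(ge0_integralZl_EFin m measurableT (fun y _ => R0 y) mR (ltW t0)).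
rewrite -(ge0_integralZl_EFin m measurableT (fun y _ => abse_ge0 _) mHE (powR_ge0 _ _)).
apply: ae_ge0_le_integral => //.
- by move=> y _; rewrite mule_ge0 // lee_fin powR_ge0.
- exact: measurable_funeM.
- by move=> y _; rewrite mule_ge0 // lee_fin ltW.
- exact: measurable_funeM.
apply: filterS le_H => y /(_ x s wx s0) h _.
rewrite /kS /= !(=^~EFinD, =^~EFinM) lee_fin; apply: le_trans h _.
by rewrite ler_wpM2l ?(ltW t0) // mulrDr [k y * s `^ q]mulrC mulrA [_ / w x]mulrC.
Qed.

Let I_fin x : G x -> (Lam x < +oo)%E -> (I x < +oo)%E.
Proof.
move=> wx Lx; have := le_I wx ltr01; rewrite powR1 mul1e => /le_lt_trans; apply.
have /fineK <- : Lam x \is a fin_num by rewrite ge0_fin_numE.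
by rewrite !(=^~EFinD, =^~EFinM) ltry.
Qed.

(** Where [Lam] is finite, [le_I] at [s = 1] bounds the integral of [|H (x, y)|] over [y]. *)
Lemma schur_integrable : {ae m, forall x, D x ->
  m.-integrable setT (fun y => (H (x, y))%:E)}.
Proof.
have iL : m.-integrable D Lam.
  apply/integrableP; split; first exact: measurable_funTS.
  under eq_integral do rewrite gee0_abs //.
  by apply: le_lt_trans int_Lam _; rewrite ltry.
have := integrable_ae mD iL; apply: filterS2 aeG => x wx Lx Dx.
apply/integrableP; split => //; apply: (I_fin wx).
by rewrite -ge0_fin_numE // Lx.
Qed.

Let Op x : R := fine (\int[m]_y (H (x, y))%:E)%E.

(** Tonelli handles nonnegative integrands, hence the split into positive and negative parts. *)
Let mOp : measurable_fun setT Op.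
Proof.
apply: measurableT_comp; first exact: fine_measurable.
have mHE : measurable_fun setT (EFin \o H) by exact/measurable_EFinP.
under eq_fun do rewrite integralE.
apply: emeasurable_funB.
- have := measurable_integral_snd m_sf (measurable_funepos mHE) (funepos_ge0 _).
  by congr measurable_fun; apply/funext => x; apply: eq_integral => y _; rewrite !funeposE.
- have := measurable_integral_snd m_sf (measurable_funeneg mHE) (funeneg_ge0 _).
  by congr measurable_fun; apply/funext => x; apply: eq_integral => y _; rewrite !funenegE.
Qed.

(** [powR_scaling_bound] with [L = Lam x / w x] gives [|Op| ^ q * w <= c * Lam] almost everywhere,
    trivially where [Lam] is infinite. The integral of [Lam] is already controlled. *)
Lemma schur_bound : (\int[m]_(x in D) (`|Op x| `^ q * w x)%:E <=
   ((2 * t * (J + 1)) `^ q * (E * J))%:E)%E.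
Proof.
set c := (2 * t * (J + 1)) `^ q.
have c0 : 0 < c by rewrite powR_gt0 // !mulr_gt0 // ltr_wpDl.
apply: (@le_trans _ _ (\int[m]_(x in D) (c%:E * Lam x))%E); last first.
  rewrite ge0_integralZl_EFin ?(ltW c0) //; last exact: measurable_funTS.
  by rewrite EFinM lee_wpmul2l // lee_fin ltW.
apply: ae_ge0_le_integral => //.
- by move=> x _; rewrite lee_fin mulr_ge0 // powR_ge0.
- apply/measurable_EFinP; apply: measurable_funTS; apply: measurable_funM => //.
  by apply: (measurableT_comp (measurable_powR q)); exact: measurableT_comp.
- by move=> x _; rewrite mule_ge0 // lee_fin ltW.
- by apply: measurable_funeM; exact: measurable_funTS.
apply: filterS aeG => x Gx Dx; have wx := w_gt0 Gx.
have [Lx|Lx] := ltP (Lam x) +oo%E; last first.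
  by move: Lx; rewrite leye_eq => /eqP ->; rewrite gt0_muley ?lte_fin // leey.
have LE : Lam x = (fine (Lam x))%:E by rewrite fineK // ge0_fin_numE.
have Ix := I_fin Gx Lx.
have I0 : (0 <= I x)%E by exact: integral_ge0.
have IE : I x = (fine (I x))%:E by rewrite fineK // ge0_fin_numE.
have OpI : `|Op x| <= fine (I x).
  rewrite /Op -fine_abse; last first.
    by apply: integrable_fin_num => //; apply/integrableP.
  rewrite fine_le ?ge0_fin_numE ?abse_ge0 //; last exact: le_abse_integral.
  exact: le_lt_trans (le_abse_integral m measurableT (mHx x)) Ix.
rewrite LE -EFinM lee_fin -ler_pdivlMr // -mulrA.
apply: le_trans (_ : (fine (I x)) `^ q <= _).
  by apply: ge0_powR_le => //; exact: le_trans q1.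
apply: powR_scaling_bound => //.
- by rewrite divr_ge0 ?fine_ge0 // ltW.
- exact: fine_ge0.
move=> s s0; have := le_I Gx s0; rewrite IE LE !(=^~EFinD, =^~EFinM) lee_fin.
by rewrite [_ / w x]mulrC.
Qed.

End SchurTest.

(** * Measurability and pointwise inequalities *)

Lemma measurable_fun_inv d (S : measurableType d) (R : realType) (f : S -> R) :
  (forall x, 0 <= f x) -> measurable_fun setT f -> measurable_fun setT (fun x => (f x)^-1).
Proof.
move=> f0 mf; under eq_fun do rewrite -powR_inv1 //.
exact: (measurableT_comp (measurable_powR _) mf).
Qed.

Section PsiMu.
Variables (R : realType) (p : nat) (K : fieldType) (absK : K -> R).
Hypotheses (p_pr : prime p) (QpK : is_Qp p absK).
Variable n' : nat.
Local Notation n := n'.+1.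
Context d (S : measurableType d) (A : S -> 'M[K]_n).
Hypothesis mA : forall i j, Kmeas p absK (fun s => A s i j).

(** [invmx] returns a singular matrix unchanged. Since [A_i(y)] is invertible only almost
    everywhere, measurability in [y] must include this case; elsewhere the adjugate gives a formula
    in the entries. *)
Lemma mnorm_invmx (M : 'M[K]_n) : mnorm absK (invmx M) =
  if absK (\det M) == 0 then mnorm absK M else
  \big[Num.max/0]_(i < n) \big[Num.max/0]_(j < n) ((absK (\det M))^-1 * absK (\adj M i j)).
Proof.
rewrite (abs_eq0 QpK) /invmx unitmxE unitfE; case: eqP => //= _.
by apply: eq_bigr => i _; apply: eq_bigr => j _; rewrite mxE (absM QpK) (absV QpK).
Qed.

Let abs_ge0K x : 0 <= absK x := abs_ge0 QpK x.
Hint Resolve abs_ge0K : core.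

Let mdet : measurable_fun setT (fun s => absK (\det (A s))).
Proof. by apply: (measurable_absK p_pr QpK); apply: (Kmeas_det p_pr QpK). Qed.

Let mnormA : measurable_fun setT (fun s => mnorm absK (A s)).
Proof. exact: (measurable_mnorm p_pr QpK). Qed.

Let mdetV : measurable_fun setT (fun s => (absK (\det (A s)))^-1).
Proof. exact: measurable_fun_inv. Qed.

Let mnormV : measurable_fun setT (fun s => mnorm absK (invmx (A s))).
Proof.
under eq_fun do rewrite mnorm_invmx.
apply: measurable_fun_ifT => //; first exact: measurable_fun_eqr.
apply: measurable_bigmax => i; apply: measurable_bigmax => j.
by apply: measurable_funM => //; apply: (measurable_absK p_pr QpK); apply: (Kmeas_adj p_pr QpK).
Qed.

Lemma measurable_weight_factor a : measurable_fun setT (fun s => weight_factor absK a (A s)).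
Proof.
rewrite /weight_factor; apply: measurable_funM.
  by apply: measurable_maxr; exact: (measurableT_comp (measurable_powR _)).
by under eq_fun do rewrite det_inv (absV QpK).
Qed.

Lemma measurable_mu_fn a q : measurable_fun setT (fun s => mu_fn absK a q (A s)).
Proof. exact: (measurableT_comp (measurable_powR _) (measurable_weight_factor a)). Qed.

Lemma measurable_psi_fn a r : measurable_fun setT (fun s => psi_fn p absK a r (A s)).
Proof.
rewrite /psi_fn; apply: measurable_funD; last first.
  by apply: measurable_funM => //; apply: measurable_funM => //; exact: measurable_funX.
apply: measurable_funD; last first.
  apply: measurableT_comp => //; rewrite /logp; apply: measurable_funM => //.
  exact: (measurableT_comp (@measurable_ln R)).
apply: measurable_funD => //; apply: measurable_funM; last exact: (measurableT_comp (measurable_powR _)).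
exact: (measurableT_comp (measurable_powR _) (measurable_weight_factor a)).
Qed.

End PsiMu.

Section RealInequalities.
Variable R : realType.

Lemma prodr_powR_le m (u th : 'I_m -> R) (S : R) : (0 < m)%N ->
  (forall i, 0 <= u i <= S) -> (forall i, 0 < th i) ->
  \prod_(i < m) u i `^ th i <= S `^ (\sum_(i < m) th i).
Proof.
case: m u th => // m u th _ uS th0.
have S0 : 0 <= S by have /andP[/le_trans h /h] := uS ord0.
apply: le_trans (_ : \prod_(i < m.+1) S `^ th i <= _).
  apply: ler_prod => i _; rewrite powR_ge0 /=; have /andP[u0 us] := uS i.
  by apply: ge0_powR_le => //; exact: ltW.
(* Adding exponents requires a nonzero base. For [S = 0] a factor of the product vanishes. *)
have [->|Sn0] := eqVneq S 0.
  by rewrite (bigD1 ord0) //= powR0 ?gt_eqF // mul0r powR_ge0.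
have Sp : 0 < S by rewrite lt_def Sn0.
rewrite (big_morph (powR S) (id1 := 1) (op1 := *%R)) ?powRr0 // => x y.
exact: gt0_powRD.
Qed.

(** The larger of [s] and [h] alone dominates, through its [q]-th power. *)
Lemma tangent_powR_le (q s h : R) : 1 <= q -> 0 < s -> 0 <= h ->
  s `^ (q - 1) * h <= s `^ q + h `^ q.
Proof.
move=> q1 s0 h0; have q10 : 0 <= q - 1 by rewrite subr_ge0.
have q0 : 0 < q by exact: lt_le_trans q1.
have e x : 0 <= x -> x `^ (q - 1) * x = x `^ q.
  by move=> x0; rewrite -{2}[x]powRr1 // -powRD ?subrK // gt_eqF.
have [hs|/ltW hs] := leP h s.
  apply: le_trans (_ : s `^ q <= _); last by rewrite lerDl powR_ge0.
  by rewrite -(e s (ltW s0)) ler_wpM2l ?powR_ge0.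
apply: le_trans (_ : h `^ q <= _); last by rewrite lerDr powR_ge0.
rewrite -(e h h0) ler_wpM2r //; apply: ge0_powR_le => //; exact: ltW.
Qed.

(* With [sum 1/q_i + sum 1/r_i = 1/q], a weighted product is at most the largest,
   hence at most the sum, of the corresponding powers. *)
Lemma weighted_product_le m (q a v : R) (qi ri ai be ph : 'I_m -> R) : (0 < m)%N ->
  1 <= q -> (forall i, 1 <= qi i) -> (forall i, 1 < ri i) ->
  \sum_(i < m) (qi i)^-1 + \sum_(i < m) (ri i)^-1 = q^-1 ->
  \sum_(i < m) ai i / qi i + \sum_(i < m) ai i / ri i = a / q ->
  0 < v -> (forall i, 0 <= be i) -> (forall i, 0 <= ph i) ->
  (\prod_(i < m) be i * \prod_(i < m) ph i) `^ q * v `^ a <=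
  \sum_(i < m) (be i `^ ri i * v `^ ai i + ph i `^ qi i * v `^ ai i).
Proof.
move=> m0 q1 qi1 ri1 hq ha v0 be0 ph0; set S := \sum_(i < m) _.
have q0 : 0 < q by exact: lt_le_trans q1.
have qi0 i : 0 < qi i by exact: lt_le_trans (qi1 i).
have ri0 i : 0 < ri i by exact: lt_trans (ri1 i).
have b0 i : 0 <= be i `^ ri i * v `^ ai i by rewrite mulr_ge0 ?powR_ge0.
have p0 i : 0 <= ph i `^ qi i * v `^ ai i by rewrite mulr_ge0 ?powR_ge0.
have le_S i : be i `^ ri i * v `^ ai i + ph i `^ qi i * v `^ ai i <= S.
  by rewrite /S (bigD1 i) //= lerDl sumr_ge0 // => j _; exact: addr_ge0.
have hb : \prod_(i < m) (be i `^ ri i * v `^ ai i) `^ (ri i)^-1 <= S `^ \sum_(i < m) (ri i)^-1.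
  apply: prodr_powR_le => // i; last by rewrite invr_gt0.
  by rewrite b0 (le_trans _ (le_S i)) // lerDl.
have hp : \prod_(i < m) (ph i `^ qi i * v `^ ai i) `^ (qi i)^-1 <= S `^ \sum_(i < m) (qi i)^-1.
  apply: prodr_powR_le => // i; last by rewrite invr_gt0.
  by rewrite p0 (le_trans _ (le_S i)) // lerDr.
have S0 : 0 <= S by apply: sumr_ge0 => i _; exact: addr_ge0.
have root (x e c : R) : 0 <= x -> 0 < e -> (x `^ e * v `^ c) `^ e^-1 = x * v `^ (c / e).
  move=> x0 e0; rewrite powRM ?powR_ge0 // -!powRrM divff ?gt_eqF //.
  by rewrite powRr1.
have hv (e c : 'I_m -> R) : \prod_(i < m) v `^ (c i / e i) = v `^ \sum_(i < m) (c i / e i).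
  by rewrite (big_morph (powR v) (id1 := 1) (op1 := *%R)) ?powRr0 // => x y; exact: gt0_powRD.
rewrite (eq_bigr (fun i => be i * v `^ (ai i / ri i))) in hb; last by move=> i _; exact: root.
rewrite (eq_bigr (fun i => ph i * v `^ (ai i / qi i))) in hp; last by move=> i _; exact: root.
rewrite !big_split /= !hv in hb hp.
set X := \prod_(i < m) be i in hb *; set Y := \prod_(i < m) ph i in hp *.
have X0 : 0 <= X by apply: prodr_ge0.
have Y0 : 0 <= Y by apply: prodr_ge0.
(* The two balance conditions enter here: the exponents of [S] add up to [1/q], those of [v] to
   [a/q]. *)
have XY : X * Y * v `^ (a / q) <= S `^ q^-1.
  rewrite -ha -hq gt0_powRD // powRD; last by rewrite hq invr_eq0 gt_eqF.
  rewrite (_ : X * Y * _ = (Y * v `^ \sum_(i < m) ai i / qi i) * (X * v `^ \sum_(i < m) ai i / ri i)); last by ring.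
  by apply: ler_pM => //; rewrite mulr_ge0 ?powR_ge0.
have := ge0_powR_le (ltW q0) _ XY; rewrite powRM ?mulr_ge0 ?powR_ge0 //.
by rewrite -!powRrM divfK ?gt_eqF // mulVf ?gt_eqF // powRr1 //; apply; rewrite ?mulr_ge0 ?powR_ge0.
Qed.

End RealInequalities.

(** * The commutator *)

Section Commutator.
Variables (R : realType) (p : nat) (K : fieldType) (absK : K -> R).
Hypotheses (p_pr : prime p) (QpK : is_Qp p absK).
Local Notation P := (p%:R : R).
Variable n' : nat.
Local Notation n := n'.+1.
Local Notation T := (Qpn p absK n).
Variable mu : {measure set T -> \bar R}.
Hypothesis haar : is_Haar mu.
Local Notation B := (Bg p absK n).
Let mB g : measurable (B g) := measurable_B g.
Hint Resolve mB : core.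
Variables (m : nat) (q a : R) (qi ri ai : 'I_m -> R).
Variables (Phi : T -> R) (A : 'I_m -> T -> 'M[K]_n) (b : 'I_m -> T -> R).
Hypotheses (m0 : (0 < m)%N) (q1 : 1 <= q).
Hypotheses (qi1 : forall i, 1 <= qi i) (ri1 : forall i, 1 < ri i).
Hypotheses (ai_gt : forall i, - n%:R < ai i) (ai_lt : forall i, ai i < n%:R * (ri i - 1)).
Hypothesis hq : \sum_(i < m) (qi i)^-1 + \sum_(i < m) (ri i)^-1 = q^-1.
Hypothesis ha : \sum_(i < m) ai i / qi i + \sum_(i < m) ai i / ri i = a / q.
Hypotheses (Phi0 : forall y, 0 <= Phi y) (mPhi : measurable_fun setT Phi).
Hypothesis mA : forall i j l, Kmeas p absK (fun y => A i y j l).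
Hypothesis uA : {ae mu, forall y, forall i, A i y \in unitmx}.
Hypothesis hb : forall i, in_CMO mu (pw (ai i)) (ri i) (b i).
Let psi i y := psi_fn p absK (ai i) (ri i) (A i y).
Let muq i y := mu_fn absK (ai i) (qi i) (A i y).
Let k y := Phi y / vnorm absK (y : 'cV[K]_n) ^+ n * \prod_(i < m) (psi i y * muq i y).
Hypothesis k_fin : (\int[mu]_y (k y)%:E < +oo)%E.

Let qi0 i : 0 < qi i. Proof. exact: lt_le_trans (qi1 i). Qed.
Let ri0 i : 0 < ri i. Proof. exact: lt_trans (ri1 i). Qed.

Let mpsi i : measurable_fun setT (psi i).
Proof. exact: (measurable_psi_fn p_pr QpK). Qed.

Let mmuq i : measurable_fun setT (muq i).
Proof. exact: (measurable_mu_fn p_pr QpK). Qed.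

Let psi_ge0 i y : 0 <= psi i y.
Proof.
by rewrite /psi /psi_fn !addr_ge0 ?mulr_ge0 ?powR_ge0 ?exprn_ge0 ?mnorm_ge0
  ?invr_ge0 ?(abs_ge0 QpK).
Qed.

Let muq_ge0 i y : 0 <= muq i y. Proof. exact: powR_ge0. Qed.

Let mkPhi : measurable_fun setT (fun y => Phi y / vnorm absK (y : 'cV[K]_n) ^+ n).
Proof.
apply: measurable_funM => //; apply: measurable_fun_inv.
  by move=> y; rewrite exprn_ge0 // vnorm_ge0.
by apply: measurable_funX; exact: measurable_vnorm.
Qed.

Let mk : measurable_fun setT k.
Proof.
apply: measurable_funM => //; apply: measurable_prod => i _.
exact: measurable_funM.
Qed.

Let k0 y : 0 <= k y.
Proof.
rewrite mulr_ge0 ?divr_ge0 ?exprn_ge0 ?vnorm_ge0 //.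
by apply: prodr_ge0 => i _; rewrite mulr_ge0.
Qed.

Let mu_sf : sigma_finite setT mu.
Proof.
exists (fun k : nat => B k%:Z) => [|i]; last by split => //; rewrite (haar_B p_pr QpK haar) ltry.
apply/esym/seteqP; split => // x _.
have [x0|x0] := eqVneq (x : 'cV[K]_n) 0.
  by exists 0%N => //; rewrite /Bg /= x0 (vnorm0 QpK) exprn_ge0.
have [l lx] := vnorm_val p_pr QpK x0.
by exists `|l|%N => //; rewrite /Bg /= lx (le_Pz R p_pr); lia.
Qed.

Let psi_ge1 i y : A i y \in unitmx -> 1 <= psi i y.
Proof.
move=> uy; have A0 : A i y != 0 by apply: contraTneq uy => ->; rewrite unitmxE det0 unitr0.
have [l Al] := mnorm_val p_pr QpK A0.
by have [] := psi_fn_ge p_pr QpK (ai i) (ri i) uy Al.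
Qed.

Let act i (z : T * T) : T := (A i z.2 *m (z.1 : 'cV[K]_n) : T).

Let mact i : measurable_fun setT (act i).
Proof.
apply: (measurable_mulmx p_pr QpK) => [j l|]; last exact: measurable_fst.
exact: (Kmeas_comp measurable_snd (mA i j l)).
Qed.

Let m_fst (h : T -> R) : measurable_fun setT h -> measurable_fun setT (fun z : T * T => h z.1).
Proof. by move=> mh; apply: (measurableT_comp mh); exact: measurable_fst. Qed.

Let m_snd (h : T -> R) : measurable_fun setT h -> measurable_fun setT (fun z : T * T => h z.2).
Proof. by move=> mh; apply: (measurableT_comp mh); exact: measurable_snd. Qed.

Let m_act i (h : T -> R) : measurable_fun setT h -> measurable_fun setT (fun z : T * T => h (act i z)).
Proof. by move=> mh; exact: (measurableT_comp mh (mact i)). Qed.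

Let mb i : measurable_fun setT (b i). Proof. by case: (hb i). Qed.

(** * Estimates for fixed functions [f], with positive bounds [t] on their norms *)

Section FixedFunctions.
Variables (f : 'I_m -> T -> R) (t : 'I_m -> R) (D : 'I_m -> R) (g : int).
Hypothesis mf : forall i, measurable_fun setT (f i).
Hypothesis t0 : forall i, 0 < t i.
Hypothesis f_le : forall i, (wint mu setT (pw (ai i)) (qi i) (f i) <= (t i `^ qi i)%:E)%E.
Hypothesis D0 : forall i, 0 <= D i.
Hypothesis D_le : forall i (M : 'M[K]_n), M \in unitmx ->
  (wint mu (B g) (pw (ai i)) (ri i) (fun x => (b i x - b i (mulmxT M x))%R) <=
     (D i * psi_fn p absK (ai i) (ri i) M `^ ri i)%:E)%E.

Let H (z : T * T) : R := Hkernel Phi A b f z.1 z.2.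

Let be i (z : T * T) : R := `|b i z.1 - b i (act i z)| / psi i z.2.
Let ph i (z : T * T) : R := `|f i (act i z)| / (muq i z.2 * t i).
Let Se i (z : T * T) : R :=
  be i z `^ ri i * @pw R p K absK n (ai i) z.1 + ph i z `^ qi i * @pw R p K absK n (ai i) z.1.
Let S (z : T * T) : R := \sum_(i < m) Se i z.

Let be0 i z : 0 <= be i z. Proof. by rewrite divr_ge0. Qed.
Let ph0 i z : 0 <= ph i z. Proof. by rewrite divr_ge0 // mulr_ge0 // ltW. Qed.
Let Se0 i z : 0 <= Se i z.
Proof. by rewrite addr_ge0 // mulr_ge0 ?powR_ge0. Qed.

Let mH : measurable_fun setT H.
Proof.
rewrite /H /Hkernel; apply: measurable_funM; last first.
  by apply: measurable_prod => i _; exact: m_act.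
apply: measurable_funM; first exact: (m_snd mkPhi).
apply: measurable_prod => i _; apply: measurable_funB; first exact: m_fst.
exact: m_act.
Qed.

Let mw c : measurable_fun setT (fun z : T * T => @pw R p K absK n c z.1).
Proof. by apply: m_fst; exact: measurable_pw. Qed.

Let mSe i : measurable_fun setT (Se i).
Proof.
have mpowR (h : T * T -> R) e : measurable_fun setT h -> measurable_fun setT (fun z => h z `^ e).
  by move=> mh; exact: (measurableT_comp (measurable_powR e) mh).
apply: measurable_funD; (apply: measurable_funM; last exact: mw); apply: mpowR;
  apply: measurable_funM.
- by apply: measurableT_comp => //; apply: measurable_funB; [exact: m_fst | exact: m_act].
- by apply: measurable_fun_inv => [z //|]; exact: m_snd.
- by apply: measurableT_comp => //; exact: m_act.
- apply: measurable_fun_inv => [z|]; first by rewrite mulr_ge0 // ltW.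
  by apply: measurable_funM => //; exact: m_snd.
Qed.

Let mS : measurable_fun setT S.
Proof. exact: measurable_sum. Qed.

Let S0 z : 0 <= S z. Proof. by apply: sumr_ge0 => i _. Qed.

(** The normalisations cancel exactly: [|H|] is the product of the [t i] times [k y * h], with [h]
    the product of all [be i] and [ph i]. Then [tangent_powR_le] isolates [h ^ q], and
    [weighted_product_le] bounds it by [S / w]. *)
Let H_le y : (forall i, A i y \in unitmx) -> forall (x : T) s, (x : 'cV[K]_n) != 0 -> 0 < s ->
  s `^ (q - 1) * `|H (x, y)| <=
    (\prod_(i < m) t i) * (k y * (s `^ q + S (x, y) / @pw R p K absK n a x)).
Proof.
move=> uy x s x0 s0; have v0 : 0 < vnorm absK (x : 'cV[K]_n) by rewrite (vnorm_gt0 QpK).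
have tp : 0 <= \prod_(i < m) t i by apply: prodr_ge0 => i _; exact: ltW.
set h := \prod_(i < m) be i (x, y) * \prod_(i < m) ph i (x, y).
have h0 : 0 <= h by rewrite mulr_ge0 ?prodr_ge0.
have HE : `|H (x, y)| = (\prod_(i < m) t i) * (k y * h).
  have bE i : `|b i x - b i (act i (x, y))| = be i (x, y) * psi i y.
    by rewrite divfK // gt_eqF // (lt_le_trans ltr01) // psi_ge1.
  have fE i : `|f i (act i (x, y))| = ph i (x, y) * (muq i y * t i).
    rewrite divfK // gt_eqF // mulr_gt0 // powR_gt0 //.
    exact: (weight_factor_gt0 QpK).
  rewrite /H /Hkernel /= !normrM !normr_prod.
  rewrite (eq_bigr (fun i => be i (x, y) * psi i y)) => [|i _]; last exact: bE.
  rewrite [X in _ * X](eq_bigr (fun i => ph i (x, y) * (muq i y * t i))) => [|i _]; last exact: fE.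
  rewrite (ger0_norm (Phi0 y)) ger0_norm ?invr_ge0 ?exprn_ge0 ?vnorm_ge0 //.
  by rewrite /k /h !big_split /=; ring.
rewrite HE mulrCA ler_wpM2l // mulrCA ler_wpM2l //.
apply: le_trans (tangent_powR_le q1 s0 h0) _; rewrite lerD2l ler_pdivlMr ?powR_gt0 //.
exact: weighted_product_le.
Qed.

(** [D i] comes from the commutator estimate after division by [psi ^ r_i]. The 1 comes from [f i]:
    the change of variables costs [mu_i ^ q_i], which cancels the normalisation, and [t i] cancels
    the norm. *)
Let int_Se i y : A i y \in unitmx -> (\int[mu]_(x in B g) (Se i (x, y))%:E <= (D i + 1)%:E)%E.
Proof.
move=> uy; set M := A i y.
pose u x := b i x - b i (mulmxT M x); pose v x := (f i \o mulmxT M) x.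
have mM : measurable_fun setT (mulmxT M : T -> T) by exact: measurable_mulmxT.
have mu_ : measurable_fun setT u by apply: measurable_funB => //; exact: (measurableT_comp (mb i) mM).
have mv : measurable_fun setT v by exact: (measurableT_comp (mf i) mM).
have psi1 := psi_ge1 uy; have psip : 0 < psi i y by exact: lt_le_trans psi1.
have wf0 := weight_factor_gt0 QpK (ai i) uy.
have mut : 0 < muq i y * t i by rewrite mulr_gt0 // powR_gt0.
pose c1 := (psi i y)^-1 `^ ri i; pose c2 := (muq i y * t i)^-1 `^ qi i.
have SeE x : (Se i (x, y))%:E =
    (c1%:E * (`|u x| `^ ri i * @pw R p K absK n (ai i) x)%:E +
     c2%:E * (`|v x| `^ qi i * @pw R p K absK n (ai i) x)%:E)%E.
  rewrite -!EFinM -EFinD /Se /be /ph powRM ?invr_ge0 //.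
  by rewrite powRM ?invr_ge0 ?(ltW mut) // /c1 /c2 /u /v /act /mulmxT /=; congr (_%:E); ring.
under eq_integral do rewrite SeE.
have mU := measurable_wint_integrand p_pr QpK (ai i) (ri i) (E := B g) mu_.
have mV := measurable_wint_integrand p_pr QpK (ai i) (qi i) (E := B g) mv.
have U0 x : (0 <= (`|u x| `^ ri i * @pw R p K absK n (ai i) x)%:E)%E.
  exact: wint_integrand_ge0.
have V0 x : (0 <= (`|v x| `^ qi i * @pw R p K absK n (ai i) x)%:E)%E.
  exact: wint_integrand_ge0.
rewrite ge0_integralD //; last 4 first.
- by move=> x _; rewrite mule_ge0 // lee_fin powR_ge0.
- exact: measurable_funeM.
- by move=> x _; rewrite mule_ge0 // lee_fin powR_ge0.
- exact: measurable_funeM.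
rewrite !ge0_integralZl_EFin ?powR_ge0 // EFinD; apply: leeD.
  apply: le_trans (lee_wpmul2l _ (D_le i uy)) _; first by rewrite lee_fin powR_ge0.
  rewrite -EFinM lee_fin mulrCA -powRM ?invr_ge0 ?(ltW psip) //.
  by rewrite mulVf ?gt_eqF // powR1 mulr1.
apply: le_trans (lee_wpmul2l _ (wint_mulmx p_pr QpK haar (ai i) (qi i) uy (mB g)
  measurableT (mf i) (fun _ _ => I))) _; first by rewrite lee_fin powR_ge0.
rewrite muleA -EFinM; apply: le_trans (lee_wpmul2l _ (f_le i)) _.
  by rewrite lee_fin mulr_ge0 ?powR_ge0 // ltW.
rewrite -EFinM lee_fin.
have -> : weight_factor absK (ai i) M = muq i y `^ qi i.
  by rewrite /muq /mu_fn -/(weight_factor _ _ _) -powRrM mulVf ?gt_eqF // powRr1 // ltW.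
rewrite -mulrA -powRM ?muq_ge0 ?(ltW (t0 i)) // -powRM ?invr_ge0 ?(ltW mut) //.
by rewrite mulVf ?gt_eqF // powR1.
Qed.

Let E := \sum_(i < m) (D i + 1).
Let E0 : 0 <= E. Proof. by apply: sumr_ge0 => i _; rewrite addr_ge0. Qed.

Let int_S y : (forall i, A i y \in unitmx) ->
  (\int[mu]_(x in B g) (S (x, y))%:E <= E%:E)%E.
Proof.
move=> uy; have mSey i : measurable_fun (B g) (fun x => (Se i (x, y))%:E).
  apply/measurable_EFinP; apply: measurable_funTS.
  by apply: (measurableT_comp (mSe i)); exact: pair2_measurable.
have -> : (\int[mu]_(x in B g) (S (x, y))%:E =
    \sum_(i < m) \int[mu]_(x in B g) (Se i (x, y))%:E)%E.
  rewrite -ge0_integral_sum //; last by move=> i x _; rewrite lee_fin.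
  by apply: eq_integral => x _; rewrite sumEFin.
rewrite /E -sumEFin; apply: lee_sum => i _; exact: int_Se.
Qed.

Let J := fine (\int[mu]_y (k y)%:E)%E.

Let kJ : (\int[mu]_y (k y)%:E = J%:E)%E.
Proof.
by rewrite /J fineK // ge0_fin_numE // integral_ge0 // => y _; rewrite lee_fin.
Qed.

Let tp : 0 < \prod_(i < m) t i. Proof. exact: prodr_gt0. Qed.

(* The weights have no meaning at the origin, where [|0|^c] is [0] or [1]. *)
Let Gx : set T := [set x : T | (x : 'cV[K]_n) != 0].

Let w_gt0 x : Gx x -> 0 < @pw R p K absK n a x.
Proof. by move=> x0; rewrite powR_gt0 // (vnorm_gt0 QpK). Qed.

Let ae_H : {ae mu, forall y, forall x s, Gx x -> 0 < s -> s `^ (q - 1) * `|H (x, y)| <=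
  (\prod_(i < m) t i) * (k y * (s `^ q + S (x, y) / @pw R p K absK n a x))}.
Proof. by apply: filterS uA => y uy x s; exact: H_le. Qed.

Let ae_S : {ae mu, forall y, (\int[mu]_(x in B g) (S (x, y))%:E <= E%:E)%E}.
Proof. by apply: filterS uA => y; exact: int_S. Qed.

Lemma Hkernel_integrable : {ae mu, forall x, B g x ->
  mu.-integrable setT (fun y => (Hkernel Phi A b f x y)%:E)}.
Proof.
have := schur_integrable mu_sf tp E0 mH mS mk (mB g) k0 S0 (fun x => powR_ge0 _ _)
  (ae_neq0 p_pr QpK haar) kJ ae_H ae_S.
by [].
Qed.

Lemma Hop_bound : (wint mu (B g) (pw a) q (Hop mu Phi A b f) <=
  ((2 * (\prod_(i < m) t i) * (J + 1)) `^ q * (E * J))%:E)%E.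
Proof.
exact: (schur_bound mu_sf q1 tp E0 mH mS mk (measurable_pw p_pr QpK a) (mB g) k0 S0
  (fun x => powR_ge0 _ _) (ae_neq0 p_pr QpK haar) w_gt0 kJ ae_H ae_S).
Qed.

End FixedFunctions.

(** The bounds [t] stand in for the norms because they must be positive. [D], [E] and [J] do not
    involve [f], so taking the [q]-th root in [Hop_bound] and removing the product of the [t i]
    gives [C]. *)
Lemma commutator_bounded g : exists2 C : R, 0 <= C & forall (f : 'I_m -> T -> R) (t : 'I_m -> R),
  (forall i, measurable_fun setT (f i)) -> (forall i, 0 < t i) ->
  (forall i, (wint mu setT (pw (ai i)) (qi i) (f i) <= (t i `^ qi i)%:E)%E) ->
  {ae mu, forall x, B g x -> mu.-integrable setT (fun y => (Hkernel Phi A b f x y)%:E)} /\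
  (wint mu (B g) (pw a) q (Hop mu Phi A b f) <= ((C * \prod_(i < m) t i) `^ q)%:E)%E.
Proof.
have /choice [D hD] : forall i, exists D : R, 0 <= D /\ forall M : 'M[K]_n, M \in unitmx ->
    (wint mu (B g) (pw (ai i)) (ri i) (fun x => (b i x - b i (mulmxT M x))%R) <=
     (D * psi_fn p absK (ai i) (ri i) M `^ ri i)%:E)%E.
  move=> i; have [D D0 hD] := cmo_commutator p_pr QpK haar (ri1 i) (ai_gt i) (ai_lt i) (hb i) g.
  by exists D.
set J := fine (\int[mu]_y (k y)%:E)%E; set E := \sum_(i < m) (D i + 1).
have q0 : 0 < q by exact: lt_le_trans q1.
have J0 : 0 <= J by apply: fine_ge0; apply: integral_ge0 => y _; rewrite lee_fin.
have E0 : 0 <= E by apply: sumr_ge0 => i _; rewrite addr_ge0 // (hD i).1.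
exists (2 * (J + 1) * (E * J) `^ q^-1) => [|f t mf t0 f_le].
  by rewrite !mulr_ge0 ?powR_ge0 ?addr_ge0.
have D0 i := (hD i).1; have D_le i := (hD i).2.
split; first exact: (Hkernel_integrable mf t0 f_le D0 D_le).
apply: le_trans (Hop_bound mf t0 f_le D0 D_le) _.
have tp : 0 <= \prod_(i < m) t i by apply: prodr_ge0 => i _; exact: ltW.
rewrite lee_fin -/J -/E mulrAC [X in _ <= X `^ q](_ : _ =
  (2 * \prod_(i < m) t i * (J + 1)) * (E * J) `^ q^-1); last by ring.
rewrite [leRHS]powRM ?powR_ge0 ?mulr_ge0 ?addr_ge0 // -powRrM mulVf ?gt_eqF //.
by rewrite powRr1 ?mulr_ge0 // mulrAC.
Qed.

End Commutator.

Unset Implicit Arguments. Set Strict Implicit. Set Printing Implicit Defensive.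

Theorem theorem4p3 (R : realType) (p : nat) (K : fieldType) (absK : K -> R)
  (n m : nat) (mu : {measure set (Qpn p absK n) -> \bar R})
  (q a : R) (qi ri ai : 'I_m -> R)
  (Phi : Qpn p absK n -> R) (A : 'I_m -> Qpn p absK n -> 'M[K]_n)
  (b : 'I_m -> Qpn p absK n -> R) :
  prime p -> is_Qp p absK -> is_Haar mu -> (0 < n)%N ->
  (1 <= m)%N -> 1 <= q ->
  (forall i, 1 <= qi i) -> (forall i, 1 < ri i) ->
  (forall i, - n%:R < ai i /\ ai i < n%:R * ri i / (ri i / (ri i - 1))) ->
  \sum_(i < m) (qi i)^-1 + \sum_(i < m) (ri i)^-1 = q^-1 ->
  \sum_(i < m) ai i / qi i + \sum_(i < m) ai i / ri i = a / q ->
  (forall y, 0 <= Phi y) -> measurable_fun setT Phi ->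
  (forall i (j k : 'I_n),
     measurable_fun setT (fun y => (const_mx (A i y j k) : Qpn p absK 1))) ->
  (forall i, {ae mu, forall y, A i y \in unitmx}) ->
  (forall i, in_CMO mu (pw (ai i)) (ri i) (b i)) ->
  (\int[mu]_y (Phi y / vnorm absK (y : 'cV[K]_n) ^+ n
      * \prod_(i < m) (psi_fn p absK (ai i) (ri i) (A i y)
                       * mu_fn absK (ai i) (qi i) (A i y)))%:E < +oo)%E ->
  forall g : int, exists C : R, forall f : 'I_m -> Qpn p absK n -> R,
    (forall i, in_wL mu (pw (ai i)) (qi i) (f i)) ->
    {ae mu, forall x, Bg p absK n g x ->
       mu.-integrable setT (fun y => (Hkernel Phi A b f x y)%:E)} /\
    (wint mu (Bg p absK n g) (pw a) q (Hop mu Phi A b f)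
       <= ((C * \prod_(i < m) wnorm mu setT (pw (ai i)) (qi i) (f i)) `^ q)%:E)%E.
Proof.
move=> p_pr QpK haar; case: n mu Phi A b haar => // n' mu' Phi' A' b' haar.
move=> _ m0 q1 qi1 ri1 hai hq ha Phi0 mPhi mA uA hb kfin g.
have q0 : 0 < q by exact: lt_le_trans q1.
have qi0 i : 0 < qi i by exact: lt_le_trans (qi1 i).
(* [ri i / (ri i - 1)] is the conjugate exponent of [ri i], so the hypothesis simplifies to this
   form. *)
have ai_lt i : ai i < n'.+1%:R * (ri i - 1).
  have := (hai i).2; congr (_ < _).
  have r0 : ri i != 0 by rewrite gt_eqF // (lt_trans ltr01).
  have r1 : ri i - 1 != 0 by rewrite gt_eqF // subr_gt0.
  by field; rewrite r0 r1.
have uA' : {ae mu', forall y, forall i, A' i y \in unitmx} by exact: filter_forall.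
have mA' i j l : Kmeas p absK (fun y => A' i y j l).
  exact: (Kmeas_of_const_mx p_pr QpK (mA i j l)).
have [C C0 hC] := commutator_bounded p_pr QpK haar m0 q1 qi1 ri1
  (fun i => (hai i).1) ai_lt hq ha Phi0 mPhi mA' uA' hb kfin g.
exists C => f hf.
pose N i := wnorm mu' setT (pw (ai i)) (qi i) (f i).
have N0 i : 0 <= N i by exact: powR_ge0.
have mf i : measurable_fun setT (f i) by case: (hf i).
have wf i : wint mu' setT (pw (ai i)) (qi i) (f i) = (N i `^ qi i)%:E.
  have w0 : (0 <= wint mu' setT (pw (ai i)) (qi i) (f i))%E by exact: wint_ge0.
  rewrite /N /wnorm -powRrM mulVf ?gt_eqF // powRr1 ?fine_ge0 // fineK //.
  by rewrite ge0_fin_numE //; case: (hf i).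
have bound t : (forall i, 0 < t i) -> (forall i, N i <= t i) ->
    (wint mu' (Bg p absK n'.+1 g) (pw a) q (Hop mu' Phi' A' b' f) <=
      ((C * \prod_(i < m) t i) `^ q)%:E)%E /\
    {ae mu', forall x, Bg p absK n'.+1 g x ->
       mu'.-integrable setT (fun y => (Hkernel Phi' A' b' f x y)%:E)}.
  move=> t0 Nt; have [] := hC f t mf t0; last by [].
  by move=> i; rewrite wf lee_fin; apply: ge0_powR_le => //; exact: ltW.
have N1 i : 0 < N i + 1 by rewrite ltr_wpDl.
split.
  (* Integrability is insensitive to the size of the bounds, so any positive ones will do. *)
  by apply: (bound (fun i => N i + 1) _ _).2 => // i; rewrite lerDl.
have [Npos|] := pselect (forall i, 0 < N i); first by have [] := bound N Npos (fun i => lexx _).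
(* Some [f_j] vanishes almost everywhere: let its normalization tend to 0. *)
move=> /existsNP[j /negP]; rewrite -leNgt => Nj0.
have Nj : N j = 0 by apply/eqP; rewrite eq_le Nj0 N0.
rewrite -/N [X in C * X](bigD1 j) //= -/(N j) Nj mul0r mulr0 powR0 ?gt_eqF //.
apply/lee_addgt0Pr => e e0; rewrite add0e.
pose Q := \prod_(i < m | i != j) (N i + 1).
have Q0 : 0 <= Q by apply: prodr_ge0 => i _; exact: ltW.
have CQ : 0 < C * Q + 1 by rewrite ltr_wpDl // mulr_ge0.
(* Chosen so that [C * (del * Q) <= e ^ (1/q)]; the added 1 keeps the denominator positive. *)
pose del := e `^ q^-1 / (C * Q + 1).
have del0 : 0 < del by rewrite divr_gt0 ?powR_gt0.
pose t i := if i == j then del else N i + 1.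
have [] := bound t.
- by move=> i; rewrite /t; case: ifP.
- by move=> i; rewrite /t; case: eqP => [->|_]; rewrite ?Nj ?lerDl // ltW.
move=> h _; apply: le_trans h _; rewrite lee_fin.
have -> : \prod_(i < m) t i = del * Q.
  rewrite (bigD1 j) //= /t eqxx; congr (_ * _); apply: eq_bigr => i /negPf ij.
  by rewrite ij.
have -> : e = (e `^ q^-1) `^ q by rewrite -powRrM mulVf ?gt_eqF // powRr1 // ltW.
apply: ge0_powR_le; [exact: ltW | by apply: mulr_ge0 => //; apply: mulr_ge0 => //; exact: ltW |].
rewrite /del mulrCA mulrAC ler_pdivrMr // ler_wpM2l ?powR_ge0 // lerDl.
exact: ler01.
Qed.
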